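(* Let $r\ge1$, $q=2^r$ and $n\ge3$. If $r$ is odd, then $$\begin{aligned}F_q(n,0,0,0)=q^{n-3}-q^{n/2-3}\Big(&\tfrac{q(q-1)(q-2)}{8}\big(1^n+(-1)^n\big)+\tfrac{q(q-1)(q+2)}{8}\big(i^n+(-i)^n\big)\\ &+\tfrac{(q-1)(q+1)(q-\sqrt{2q})}{12}\big(\omega_{24}^{n}+\omega_{24}^{7n}+\omega_{24}^{17n}+\omega_{24}^{23n}\big)\\ &+\tfrac{(q-1)(q+1)(q+\sqrt{2q})}{12}\big(\omega_{24}^{5n}+\omega_{24}^{11n}+\omega_{24}^{13n}+\omega_{24}^{19n}\big)\\ &+\tfrac{(q-1)(q-\sqrt{2q})(5q+\sqrt{2q}+4)}{24}\big(\omega_8^{n}+\omega_8^{7n}\big)\\ &+\tfrac{(q-1)(q+\sqrt{2q})(5q-\sqrt{2q}+4)}{24}\big(\omega_8^{3n}+\omega_8^{5n}\big)\Big).\end{aligned}$$ If $r$ is even, then $$\begin{aligned}F_q(n,0,0,0)=q^{n-3}-q^{n/2-3}\Big(&\tfrac{(q-1)(q-2\sqrt q)(5q+2\sqrt q+4)}{24}\,1^n+\tfrac{(q-1)(q+2\sqrt q)(5q-2\sqrt q+4)}{24}(-1)^n\\ &+\tfrac{q(q-1)(5q+4)}{24}\big(i^n+(-i)^n\big)\\ &+\tfrac{q^2(q-1)}{8}\big(\omega_8^{n}+\omega_8^{7n}+\omega_8^{3n}+\omega_8^{5n}\big)\\ &+\tfrac{q(q-1)^2}{12}\big(\omega_{12}^{n}+\omega_{12}^{5n}+\omega_{12}^{7n}+\omega_{12}^{11n}\big)\\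 &+\tfrac{(q-1)(q-\sqrt q)(q-\sqrt q+2)}{12}\big(\omega_6^{n}+\omega_6^{5n}\big)\\ &+\tfrac{(q-1)(q+\sqrt q)(q+\sqrt q+2)}{12}\big(\omega_6^{2n}+\omega_6^{4n}\big)\Big).\end{aligned}$$
   Context: $\omega_k=e^{2\pi i/k}\in\mathbb C$, and $q^{n/2}$, $\sqrt q$, $\sqrt{2q}$ denote positive real roots. For $a\in\mathbb F_{q^n}$ put $T_1(a)=\sum_{0\le i\le n-1}a^{q^i}$, $T_2(a)=\sum_{0\le i<j\le n-1}a^{q^i+q^j}$, $T_3(a)=\sum_{0\le i<j<k\le n-1}a^{q^i+q^j+q^k}$. $F_q(n,0,0,0)$ is the number of $a\in\mathbb F_{q^n}$ with $T_1(a)=T_2(a)=T_3(a)=0$. *)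

(* Defs.v *)
From mathcomp Require Import all_boot all_order all_algebra.
From mathcomp Require Import reals exp trigo.
From mathcomp Require Import complex.

Set Implicit Arguments.
Unset Strict Implicit.
Unset Printing Implicit Defensive.

Import Order.TTheory GRing.Theory Num.Theory.

#[global] Open Scope ring_scope.

(* [F] is meant to be the field with [q ^ n] elements, so that [T1], [T2] and
   [T3] are the first three elementary symmetric functions of the conjugates of
   [a] over the subfield with [q] elements. *)
Definition T1 (F : finFieldType) (q n : nat) (a : F) : F :=
  \sum_(i < n) a ^+ (q ^ i)%N.

Definition T2 (F : finFieldType) (q n : nat) (a : F) : F :=
  \sum_(i < n) \sum_(j < n | (i < j)%N) a ^+ (q ^ i + q ^ j)%N.

Definition T3 (F : finFieldType) (q n : nat) (a : F) : F :=
  \sum_(i < n) \sum_(j < n | (i < j)%N) \sum_(k < n | (j < k)%N)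
    a ^+ (q ^ i + q ^ j + q ^ k)%N.

Definition trace_count (F : finFieldType) (q n : nat) (t1 t2 t3 : F) : nat :=
  #|[set a : F | [&& T1 q n a == t1, T2 q n a == t2 & T3 q n a == t3]]|.

(* e^(2 pi i / k), written with Euler's formula. *)
Definition omega (R : realType) (k : nat) : R[i] :=
  Complex (cos (2 * pi / k%:R)) (sin (2 * pi / k%:R)).

(* Main.v *)
From HB Require Import structures.
Require Import Defs.
From mathcomp Require Import all_boot all_order all_algebra all_field.
From mathcomp Require Import ring lra zify.
From mathcomp Require Import reals exp trigo.
From mathcomp Require Import complex.

Set Implicit Arguments.
Unset Strict Implicit.
Unset Printing Implicit Defensive.

Import Order.TTheory GRing.Theory Num.Theory.

(** The conditions on an element concern the three coefficients below the
    leading one of its characteristic polynomial over the field [K] with [q]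
    elements.  They say that a triple of elements of [K] is the neutral element
    of the group of truncated series [1 + a X + b X^2 + c X^3], which has order
    [q^3]; hence they are detected by averaging over the [q^3] characters of
    this group.  The characters are explicit: they are products of an additive
    character of the third power sum [a^3 + a b + c] and of a character of
    order 4 of the Witt vectors [(a, b)] of length 2 ([triple_char],
    [triple_char_sum]).

    A character defines a completely multiplicative function on monic
    polynomials over [K].  Its L-series is a polynomial [1 + c1 u + c2 u^2] if
    the character is nontrivial, because the top three coefficients of a
    polynomial of degree at least 3 are independent.  The logarithmic
    derivative of the Euler product ([newton_identity]) then says that the sum
    of the character over the elements of the field with [q^n] elements is
    minus the sum of the [n]-th powers of the two reciprocal roots.

    Everything is thus reduced to sums over [K].  There [c2] is [0] or [q] times
    one value of the character, and [c1] is a sum of values of a quadratic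
    function, whose square is computed by the usual change of variables:
    [c1^2 = rho c2], where [rho] is a sum over the radical of the bilinear form
    attached to the character, and is [0] or the order [1], [2] or [4] of this
    radical ([lin_sum_sqr_neq0], [radical_sum_sqr]).  So the nonzero reciprocal
    roots are [sqrt q] times roots of unity of order dividing 24.  Their phases are
    not determined one by one; summing over the characters which differ by an
    additive character of [a] replaces them by orthogonality
    ([twisted_sum]).

    The remaining statistics is the joint distribution of the order of the
    radical and of a sign.  The radical consists of [0] and the roots of a
    cubic, and the number of roots of this cubic is governed by the solvability
    of equations [y^2 + y = u] ([radical_statistics]).  The resulting formula
    depends on [n] modulo 24 only, up to powers of [sqrt q], and is compared
    with the stated one residue by residue. *)

(** * Finite fields *)

Section CharacteristicTwo.
Variables (A : fieldType) (char2 : 2%N \in [pchar A]).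
Implicit Types (x y z : A).

Lemma two_pchar2 : 2 = 0 :> A.
Proof. by apply/eqP; rewrite -(dvdn_pcharf char2). Qed.

Lemma addr_eq0_pchar2 x y : (x + y == 0) = (x == y).
Proof. by rewrite addr_eq0 oppr_pchar2. Qed.

(** Polynomial identities of characteristic 2 are proved below by exhibiting
    [z], which leaves an identity over the integers. *)
Lemma eq_mod_two z x y : x = y + 2 * z -> x = y.
Proof. by rewrite two_pchar2 mul0r addr0. Qed.

Lemma sqr_inj_pchar2 : injective (fun x : A => x ^+ 2).
Proof. by move=> x y /eqP; rewrite eqf_sqr oppr_pchar2 // orbb => /eqP. Qed.

Lemma mulrn_odd x j : x *+ j = if odd j then x else 0.
Proof.
rewrite -[j in LHS]odd_double_half mulrnDr -mul2n mulrnA mulr2n.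
rewrite (addrr_pchar2 char2) mul0rn addr0.
by case: (odd j); rewrite ?mulr1n ?mulr0n.
Qed.
End CharacteristicTwo.

Section FixedSubfield.
Variables (F : finFieldType) (p r : nat) (hp : p \in [pchar F]).

(** The hypothesis on the characteristic is an argument, so that the closure
    properties that rely on it can be attached to the predicate. *)
Definition frob_fixed of p \in [pchar F] := [pred x : F | x ^+ (p ^ r) == x].
Local Notation S := (frob_fixed hp).

Lemma frob_fixed_divring : divring_closed S.
Proof.
have pn : p.-nat (p ^ r)%N by rewrite pnatX pnat_id ?(pcharf_prime hp).
have additive (x y : F) : (x - y) ^+ (p ^ r) = x ^+ (p ^ r) - y ^+ (p ^ r).
  by rewrite exprDn_pchar ?exprNn_pchar ?(eq_pnat _ (pcharf_eq hp)).
split=> [|x y|x y]; rewrite !inE ?expr1n //.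
  by rewrite additive => /eqP-> /eqP->.
by rewrite exprMn exprVn => /eqP-> /eqP->.
Qed.
HB.instance Definition _ := GRing.isDivringClosed.Build F S frob_fixed_divring.

Record fixed_subfield := FixedSubfield { fixed_val : F; _ : fixed_val \in S }.
HB.instance Definition _ := [isSub for fixed_val].
HB.instance Definition _ := [Finite of fixed_subfield by <:].
HB.instance Definition _ := [SubChoice_isSubIntegralDomain of fixed_subfield by <:].
HB.instance Definition _ := [SubIntegralDomain_isSubField of fixed_subfield by <:].

Definition fixed_emb : {rmorphism fixed_subfield -> F} :=
  GRing.RMorphism.clone _ _ (val : fixed_subfield -> F) _.

(** [X^q - X] divides [X^(q^n) - X], which is the product of the [X - x] over
    the elements [x] of [F]. *)
Lemma card_fixed_subfield n : #|F| = ((p ^ r) ^ n)%N -> (0 < r)%N ->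
  #|{: fixed_subfield}| = (p ^ r)%N.
Proof.
move=> cF r_gt0; set q := (p ^ r)%N in cF *.
have q_gt1 : (1 < q)%N.
  by rewrite -(exp1n r) ltn_exp2r ?prime_gt1 // (pcharf_prime hp).
have Dpoly (m : nat) : (0 < m)%N ->
    'X^m - 'X = ('X^(m.-1) - 1) * 'X :> {poly F}.
  by move=> m0; rewrite mulrBl mul1r -exprSr prednK.
have qX_dvd : ('X^q - 'X : {poly F}) %| \prod_x ('X - x%:P).
  have q_gt0 := ltnW q_gt1.
  rewrite -finField_genPoly cF !Dpoly ?(expn_gt0 q) ?q_gt0 //.
  apply: dvdp_mul => //.
  have -> : (q ^ n).-1 = (q.-1 * \sum_(i < n) q ^ i)%N by rewrite predn_exp.
  rewrite exprM -[X in _ %| _ - X](expr1n _ (\sum_(i < n) q ^ i)%N) subrXX.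
  by rewrite dvdp_mulr.
have [m] := dvdp_prod_XsubC qX_dvd; set s := mask m _ => Ds.
have us : uniq s by rewrite mask_uniq // index_enum_uniq.
have ss : size s = q.
  apply: succn_inj; rewrite -(size_prod_XsubC _ id) -(eqp_size Ds).
  by rewrite size_polyDl size_polyXn // size_polyN size_polyX.
rewrite -ss -(card_uniqP us) -(card_image val_inj); apply: eq_card => x.
rewrite -[RHS]root_prod_XsubC -(eqp_root Ds) rootE !hornerE subr_eq0.
apply/imageP/idP => [[[y Sy] _ ->]|Sx]; first by [].
by exists (FixedSubfield (Sx : x \in S)).
Qed.

End FixedSubfield.

(** Finitely many polynomials have degree at most [n]: a splitting field of
    their product serves all of them. *)
Lemma small_degree_splitting_field (F : finFieldType) (n : nat) :
  exists (L : finFieldType) (j : {rmorphism F -> L}),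
  forall f : {poly F}, f \is monic -> (size f <= n.+1)%N ->
  exists s : seq L, map_poly j f = \prod_(x <- s) ('X - x%:P).
Proof.
pose P : {poly F} := \prod_(v : 'rV[F]_n.+1 | rVpoly v != 0) rVpoly v.
have nzP : P != 0 by rewrite prodf_seq_neq0; apply/allP => v _; apply/implyP.
have [L [rs Drs _]] := FinSplittingFieldFor nzP.
pose Lf : finFieldType := finvect_type L.
pose j : {rmorphism F -> Lf} := GRing.RMorphism.clone _ _ (in_alg L) _.
exists Lf, j => f mf sf.
have nzf := monic_neq0 mf.
have Df : rVpoly (poly_rV f : 'rV_n.+1) = f by rewrite poly_rV_K.
have dvP : f %| P.
  by rewrite /P (bigD1 (poly_rV f)) /= ?Df // dvdp_mulIl.
have : map_poly j f %| \prod_(x <- rs) ('X - x%:P).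
  by rewrite -(eqp_dvdr _ Drs) dvdp_map.
move/dvdp_prod_XsubC=> [m Em]; exists (mask m rs).
by apply/eqP; rewrite -eqp_monic ?monic_prod_XsubC // map_monic.
Qed.

(** * Multisets stable under a permutation *)

Section InvariantMultisets.
Local Open Scope nat_scope.
Variables (T : finType) (f : T -> T) (f_inj : injective f).
Implicit Types (a x : T) (s : seq T) (k j : nat).

Lemma iter_order_mul a j : iter (order f a * j) f a = a.
Proof.
elim: j => [|j IHj]; first by rewrite muln0.
by rewrite mulnS iterD IHj iter_order.
Qed.

Lemma iter_fixed_dvd a k : (iter k f a == a) = (order f a %| k).
Proof.
rewrite {1}(divn_eq k (order f a)) addnC iterD mulnC iter_order_mul /dvdn.
have lt_r : k %% order f a < order f a by rewrite ltn_mod order_gt0.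
by apply/eqP/eqP => [/(congr1 (findex f a))|->//]; rewrite findex_iter ?findex0.
Qed.

(** A trajectory of length [j] times the orbit length goes [j] times around. *)
Lemma count_traject a j x :
  count_mem x (traject f a (order f a * j)) = ((x \in orbit f a) * j)%N.
Proof.
elim: j => [|j IHj]; first by rewrite !muln0.
rewrite mulnS addnC trajectD count_cat IHj iter_order_mul mulnS addnC.
by rewrite -/(orbit f a) count_uniq_mem ?orbit_uniq.
Qed.

Definition submultiset s1 s2 := [forall x, count_mem x s1 <= count_mem x s2].

Lemma submultiset_size s1 s2 : submultiset s1 s2 -> size s1 <= size s2.
Proof.
move/forallP/count_subseqP => [s /size_subseq le_s /perm_size->] //.
Qed.

Lemma count_invariant_orbit s a x :
  (forall y, count_mem (f y) s = count_mem y s) ->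
  x \in orbit f a -> count_mem x s = count_mem a s.
Proof.
move=> s_inv; rewrite -fconnect_orbit => /iter_findex <-.
by elim: (findex f a x) => //= k <-.
Qed.

Lemma submultiset_traject s a j :
  (forall y, count_mem (f y) s = count_mem y s) ->
  submultiset (traject f a (order f a * j)) s = (j <= count_mem a s).
Proof.
move=> s_inv; apply/forallP/idP => [/(_ a)|le_j x]; rewrite count_traject.
  by rewrite -fconnect_orbit connect0 mul1n.
have [ax|_] := boolP (x \in orbit f a); last by [].
by rewrite (count_invariant_orbit s_inv ax) mul1n.
Qed.

(** The times [k] that return [a] to itself are the multiples [j d] of its
    orbit length [d], and by stability of [s] the trajectory of length [j d] is
    contained in [s] exactly for [j] up to the multiplicity of [a]. *)
Lemma count_periods s a :
  (forall y, count_mem (f y) s = count_mem y s) ->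
  (\sum_(1 <= k < (size s).+1)
     ((iter k f a == a) && submultiset (traject f a k) s))%N = count_mem a s.
Proof.
move=> s_inv; set d := order f a; set m := count_mem a s.
rewrite -big_mkcond /= sum1_count -size_filter.
rewrite -[m](size_iota 1) -[RHS](size_map (muln d)).
have d_gt0 : 0 < d by apply: order_gt0.
apply/perm_size; apply: uniq_perm.
- by rewrite filter_uniq ?iota_uniq.
- rewrite map_inj_uniq ?iota_uniq // => x y /eqP.
  by rewrite eqn_pmul2l // => /eqP.
move=> k; rewrite mem_filter mem_index_iota iter_fixed_dvd -/d.
apply/idP/mapP => [/andP[/andP[/dvdnP[j ->]]]|[j j_in ->]].
  rewrite mulnC submultiset_traject // => le_j /andP[j_gt0 _]; exists j => //.
  by rewrite mem_iota add1n ltnS le_j andbT; case: j j_gt0 {le_j}; rewrite ?muln0.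
rewrite mem_iota add1n ltnS in j_in; have /andP[j_gt0 le_j] := j_in.
have sub_j : submultiset (traject f a (d * j)) s by rewrite submultiset_traject.
rewrite dvdn_mulr //= sub_j muln_gt0 d_gt0 j_gt0 /=.
by have := submultiset_size sub_j; rewrite size_traject.
Qed.

Lemma sum_count_mem s : (\sum_(a : T) count_mem a s)%N = size s.
Proof.
elim: s => [|x s IHs] /=; first by rewrite big1.
rewrite big_split /= IHs -add1n; congr addn.
by rewrite (bigD1 x) //= eqxx big1 // => a /negPf; rewrite eq_sym => ->.
Qed.

End InvariantMultisets.

(** * Conjugates and Newton's identity *)

Section MonicPolynomials.
Variable K : finFieldType.
Implicit Types (f g : {poly K}) (n k : nat).

Definition monic_polys n : seq {poly K} := [seq 'X^n + rVpoly c | c : 'rV[K]_n].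

(** The sums over monic polynomials run over this sequence, and are rearranged
    by means of the following characterization of its entries. *)
Lemma mem_monic_polys n f :
  (f \in monic_polys n) = (f \is monic) && (size f == n.+1).
Proof.
apply/imageP/andP => [[c _ ->]|[mf /eqP sf]].
  have lt_c : (size (rVpoly c) < size ('X^n : {poly K}))%N.
    by rewrite size_polyXn ltnS size_poly.
  by rewrite monicE lead_coefDl // lead_coefXn size_polyDl // size_polyXn.
exists (poly_rV (f - 'X^n)) => //; rewrite poly_rV_K; first by rewrite addrC subrK.
have le_n : (size (f - 'X^n)%R <= n.+1)%N.
  by rewrite (leq_trans (size_polyD _ _)) // size_polyN size_polyXn sf maxnn.
apply/leq_sizeP => j; rewrite leq_eqVlt => /predU1P[<-|lt_nj].
  by rewrite coefB coefXn eqxx -(monicP mf) lead_coefE sf subrr.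
by rewrite (leq_sizeP _ _ le_n).
Qed.

Lemma monic_polys_uniq n : uniq (monic_polys n).
Proof.
rewrite map_inj_uniq ?enum_uniq // => c d /addrI /(congr1 (@poly_rV _ n)).
by rewrite !rVpolyK.
Qed.

Lemma perm_monic_multiples n k f : f \is monic -> size f = k.+1 -> (k <= n)%N ->
  perm_eq [seq g <- monic_polys n | f %| g] [seq f * g | g <- monic_polys (n - k)].
Proof.
move=> mf sf le_kn; have nzf := monic_neq0 mf.
apply: uniq_perm.
- by rewrite filter_uniq ?monic_polys_uniq.
- by rewrite map_inj_uniq ?monic_polys_uniq //; apply: mulfI.
move=> g; rewrite mem_filter mem_monic_polys.
apply/andP/mapP => [[/dvdpP[h ->]]|[h]].
  rewrite monicMr // => /andP[mh]; rewrite size_monicM ?monic_neq0 // sf addnS /=.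
  move=> /eqP sh; exists h; rewrite 1?mulrC // mem_monic_polys mh /=.
  by rewrite -(addnK k (size h)) sh subSn.
rewrite mem_monic_polys => /andP[mh /eqP sh] ->.
rewrite dvdp_mulr // monicMl // mh size_monicM ?monic_neq0 // sf sh addnS /=.
by rewrite addSn subnKC.
Qed.

End MonicPolynomials.

Section Descent.
Variables (K L : finFieldType) (i : {rmorphism K -> L}).
Hypothesis q_nat : [pchar L].-nat #|K|.

(** The embedding fixes the two fields; the map itself only depends on [#|K|]. *)
Definition frob of {rmorphism K -> L} := fun x : L => x ^+ #|K|.
Local Notation phi := (frob i).

Fact frob_is_zmod_morphism : zmod_morphism phi.
Proof. by move=> x y; rewrite /frob exprDn_pchar // exprNn_pchar. Qed.
Fact frob_is_monoid_morphism : monoid_morphism phi.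
Proof. by split=> [|x y]; rewrite /frob ?expr1n ?exprMn. Qed.
HB.instance Definition _ :=
  GRing.isZmodMorphism.Build L L phi frob_is_zmod_morphism.
HB.instance Definition _ :=
  GRing.isMonoidMorphism.Build L L phi frob_is_monoid_morphism.

Lemma iter_frob k x : iter k phi x = x ^+ (#|K| ^ k).
Proof. by elim: k => [|k IHk]; rewrite ?expr1 //= IHk /frob -exprM expnSr. Qed.

Lemma frob_inj : injective phi.
Proof. exact: fmorph_inj. Qed.

Lemma frob_emb y : phi (i y) = i y.
Proof. by rewrite /frob -rmorphXn expf_card. Qed.

(** Over [L] the polynomial [X^q - X] is the product of the [X - i y]. *)
Lemma frob_fixedP x : reflect (exists y, x = i y) (phi x == x).
Proof.
apply: (iffP eqP) => [xE|[y ->]]; last exact: frob_emb.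
have /(congr1 (map_poly i)) := finField_genPoly K.
rewrite map_prod_XsubC rmorphB /= map_polyXn map_polyX => /(congr1 (horner^~ x)).
rewrite !hornerE -/(phi x) xE subrr => /esym/eqP; rewrite horner_prod prodf_seq_eq0.
by case/hasP=> y _ /=; rewrite hornerXsubC subr_eq0 => /eqP; exists y.
Qed.

Definition emb_inv (x : L) : K := odflt 0 [pick y | i y == x].

Lemma embK : cancel i emb_inv.
Proof.
move=> y; rewrite /emb_inv; case: pickP => [z /eqP/fmorph_inj //|/(_ y)].
by rewrite eqxx.
Qed.

Lemma emb_invK x : phi x = x -> i (emb_inv x) = x.
Proof. by move/eqP/frob_fixedP => [y ->]; rewrite embK. Qed.

Lemma emb_inv0 : emb_inv 0 = 0. Proof. by rewrite -(rmorph0 i) embK. Qed.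

Lemma poly_descent (p : {poly L}) :
  map_poly phi p = p -> map_poly i (map_poly emb_inv p) = p.
Proof.
move=> p_fix; apply/polyP => k.
rewrite coef_map /= coef_map_id0 ?emb_inv0 // emb_invK //.
by rewrite -[in LHS](coef_map phi) p_fix.
Qed.

(** When [a] is fixed by the [k]-th power of Frobenius, this is the
    characteristic polynomial of [a] for the extension of degree [k]; it then
    descends to [K]. *)
Definition conj_poly k a : {poly L} := \prod_(x <- traject phi a k) ('X - x%:P).

Lemma conj_poly_fixed k a : iter k phi a = a ->
  map_poly phi (conj_poly k a) = conj_poly k a.
Proof.
move=> ka; rewrite map_prod_XsubC -(big_map phi xpredT (fun x => 'X - x%:P)).
apply: perm_big; rewrite -(perm_cons a).
have -> : map phi (traject phi a k) = traject phi (phi a) k.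
  by elim: k (a) {ka} => //= k IHk b; rewrite IHk.
by rewrite -trajectS trajectSr ka perm_rcons.
Qed.

Definition char_poly_over k a : {poly K} := map_poly emb_inv (conj_poly k a).

Lemma map_char_poly_over k a : iter k phi a = a ->
  map_poly i (char_poly_over k a) = conj_poly k a.
Proof. by move/conj_poly_fixed/poly_descent. Qed.

Lemma size_conj_poly k a : size (conj_poly k a) = k.+1.
Proof. by rewrite size_prod_XsubC size_traject. Qed.

Lemma char_poly_over_monic k a : iter k phi a = a ->
  char_poly_over k a \is monic.
Proof.
by move=> ka; rewrite -(map_monic i) map_char_poly_over // monic_prod_XsubC.
Qed.

Lemma size_char_poly_over k a : iter k phi a = a ->
  size (char_poly_over k a) = k.+1.
Proof.
by move=> ka; rewrite -(size_map_poly i) map_char_poly_over // size_conj_poly.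
Qed.

Lemma dvdp_prod_submultiset (s t : seq L) :
  (\prod_(x <- s) ('X - x%:P) %| \prod_(x <- t) ('X - x%:P))
    = submultiset s t.
Proof.
apply/idP/forallP => [/dvdp_prod_XsubC[m Em] x|/count_subseqP[u /subseqP[m _ ->] us]].
  rewrite eqp_monic ?monic_prod_XsubC // in Em.
  by have /eqP := Em; move/prod_XsubC_eq/seq.permP->; rewrite leq_count_mask.
rewrite (perm_big _ us) /=; elim: m t {u us} => [|b m IHm] [|x t];
  rewrite ?mask0 ?mask0s ?big_nil ?dvd1p //.
by case: b => /=; rewrite !big_cons ?dvdp_mul2l ?polyXsubC_eq0 ?dvdp_mull.
Qed.

(** Each root [a] of [f] contributes its multiplicity: the roots of [f] are
    stable under Frobenius, so [count_periods] applies to them. *)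
Lemma count_conjugate_divisors n (f : {poly K}) (s : seq L) :
  size f = n.+1 -> map_poly i f = \prod_(x <- s) ('X - x%:P) ->
  (\sum_(1 <= k < n.+1) \sum_(a | iter k phi a == a)
    ((char_poly_over k a %| f)%R : nat))%N = n.
Proof.
move=> sf fE; have sn : size s = n.
  by apply: succn_inj; rewrite -sf -(size_map_poly i) fE size_prod_XsubC.
have s_inv y : count_mem (phi y) s = count_mem y s.
  have : perm_eq (map phi s) s.
    apply: prod_XsubC_eq; rewrite big_map -(map_prod_XsubC phi) -fE.
    by rewrite -map_poly_comp; apply: eq_map_poly => x /=; rewrite frob_emb.
  move/seq.permP => <-; rewrite count_map; apply: eq_count => x /=.
  by rewrite (inj_eq frob_inj).
rewrite -[RHS]sn -[RHS](sum_count_mem s).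
under [RHS]eq_bigr => a _ do rewrite -(count_periods frob_inj a s_inv) sn.
rewrite [RHS]exchange_big; apply: eq_bigr => k _ /=.
rewrite big_mkcond; apply: eq_bigr => a _; case: ifP => //= /eqP ka.
by rewrite -(dvdp_map i) fE map_char_poly_over // dvdp_prod_submultiset.
Qed.

Section NewtonIdentity.
Variables (C : comNzRingType) (chi : {poly K} -> C).
Hypothesis chiM : forall f g, f \is monic -> g \is monic ->
  chi (f * g) = chi f * chi g.

Definition poly_sum n : C := \sum_(f <- monic_polys K n) chi f.
Definition point_sum k : C := \sum_(a | iter k phi a == a) chi (char_poly_over k a).

(** This is the coefficient of [u^n] in [u L' = (u L'/L) L], where [L] is the
    L-series of [chi] and [u L'/L] is read off its Euler product.  It is proved
    by counting in two ways the pairs of a polynomial [f] of degree [n] and of a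
    characteristic polynomial dividing it; the extension [L] is used to see
    that a given [f] has [n] of them. *)
Lemma newton_identity n :
  (forall f : {poly K}, f \is monic -> (size f <= n.+1)%N ->
     exists s, map_poly i f = \prod_(x <- s) ('X - x%:P)) ->
  n%:R * poly_sum n = \sum_(1 <= k < n.+1) point_sum k * poly_sum (n - k).
Proof.
move=> splits; rewrite mulr_sumr.
transitivity (\sum_(f <- monic_polys K n) \sum_(1 <= k < n.+1)
    \sum_(a | iter k phi a == a) if char_poly_over k a %| f then chi f else 0).
  apply: eq_big_seq => f; rewrite mem_monic_polys => /andP[mf /eqP sf].
  have [|s fE] := splits f mf; first by rewrite sf.
  rewrite -{1}(count_conjugate_divisors sf fE) natr_sum mulr_suml.
  apply: eq_bigr => k _; rewrite natr_sum mulr_suml; apply: eq_bigr => a _.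
  by case: ifP; rewrite ?mul1r ?mul0r.
rewrite exchange_big; apply: eq_big_nat => k /andP[_ le_kn] /=.
rewrite exchange_big mulr_suml; apply: eq_bigr => a /eqP ka /=.
have mk := char_poly_over_monic ka.
rewrite -big_mkcond -big_filter.
rewrite (perm_big _ (perm_monic_multiples mk (size_char_poly_over ka) le_kn)).
rewrite big_map mulr_sumr; apply: eq_big_seq => g.
by rewrite mem_monic_polys => /andP[mg _]; rewrite chiM.
Qed.
End NewtonIdentity.
End Descent.

(** * Top coefficients of monic polynomials *)

Section TopCoefficients.
Variable A : comNzRingType.
Implicit Types (p f g : {poly A}) (a b j : nat).

(** In the product the range of summation shrinks to [a - j <= l <= a], since
    the factors vanish elsewhere. *)
Lemma coefM_top p g a b j : (size p <= a.+1)%N -> (size g <= b.+1)%N ->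
  (j <= a)%N -> (j <= b)%N ->
  (p * g)`_(a + b - j) = \sum_(l < j.+1) p`_(a - l) * g`_(b - (j - l)).
Proof.
move=> sp sg le_ja le_jb; rewrite coefM.
rewrite -(big_mkord xpredT (fun l => p`_l * g`_(a + b - j - l))).
rewrite (@big_cat_nat _ _ _ (a - j)%N) //=; last lia.
rewrite [X in _ + X](@big_cat_nat _ _ _ a.+1) //=; try lia.
rewrite big_nat_cond big1 ?add0r; last first.
  move=> l /andP[/andP[_ lt_l] _].
  by rewrite [g`__]nth_default ?mulr0 // (leq_trans sg) //; lia.
rewrite [X in _ + X]big_nat_cond [X in _ + X]big1 ?addr0; last first.
  move=> l /andP[/andP[lt_l _] _].
  by rewrite nth_default ?mul0r // (leq_trans sp).
rewrite -{1}[(a - j)%N]add0n big_addn big_mkord.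
have -> : (a.+1 - (a - j) = j.+1)%N by lia.
rewrite (reindex_inj rev_ord_inj) /=; apply: eq_bigr => l _.
by congr (p`__ * g`__); have := ltn_ord l; lia.
Qed.

(** For [j <= 3] the coefficient of [X^(deg f - j)] in [f]; thanks to the factor
    [X^3] the truncated subtraction is harmless, and the value is [0] when [j]
    exceeds the degree. *)
Definition top_coef j f := ('X^3 * f)`_((size f).+2 - j).

Lemma top_coefM j f g : (j <= 3)%N -> f \is monic -> g \is monic ->
  top_coef j (f * g) = \sum_(l < j.+1) top_coef l f * top_coef (j - l) g.
Proof.
move=> le_j mf mg.
have sX (h : {poly A}) : h \is monic -> size ('X^3 * h) = ((size h).+2).+1.
  by move=> mh; rewrite size_monicM ?monicXn ?monic_neq0 // size_polyXn.
have s0 (h : {poly A}) : h \is monic -> (0 < size h)%N.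
  by move=> mh; rewrite size_poly_gt0 monic_neq0.
have := s0 _ mf; have := s0 _ mg => sg sf.
have := @coefM_top ('X^3 * f) ('X^3 * g) (size f).+2 (size g).+2 j.
rewrite !sX // !leqnn => /(_ isT isT) <-; try lia.
rewrite /top_coef size_monicM ?monic_neq0 //.
have -> : 'X^3 * f * ('X^3 * g) = 'X^3 * ('X^3 * (f * g)) by ring.
rewrite [RHS]coefXnM ifF; last lia.
by congr _`__; lia.
Qed.

Lemma top_coef0 f : f \is monic -> top_coef 0 f = 1.
Proof.
move=> mf; rewrite /top_coef subn0 coefXnM ifF; last first.
  by have : (0 < size f)%N by [rewrite size_poly_gt0 monic_neq0]; lia.
by rewrite -[RHS](monicP mf) lead_coefE; congr _`__; lia.
Qed.

Lemma top_coef_XaddC j f c : f != 0 -> (0 < j <= 3)%N ->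
  top_coef j (f * 'X + c%:P) = top_coef j f + (if size f == j then c else 0).
Proof.
move=> nzf le_j; have sf : (0 < size f)%N by rewrite size_poly_gt0.
rewrite /top_coef size_MXaddC (negPf nzf) /= !coefXnM coefD coefMX coefC.
move: (size f) sf => n n_gt0.
case: ltnP => le3; first by rewrite ifT ?ifF ?addr0 //; lia.
rewrite [RHS]addrC [LHS]addrC; congr (_ + _).
  by case: ifP => [/eqP|] h; case: ifP => // /eqP h2; exfalso; lia.
case: ifP => [/eqP|] h; case: ifP => // h2; try by exfalso; lia.
by congr _`__; lia.
Qed.

Lemma top_coef1 j : (0 < j <= 3)%N -> top_coef j (1 : {poly A}) = 0.
Proof.
by move=> le_j; rewrite /top_coef size_poly1 mulr1 coefXn; case: eqP => //; lia.
Qed.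

Lemma top_coefM1 f g : f \is monic -> g \is monic ->
  top_coef 1 (f * g) = top_coef 1 f + top_coef 1 g.
Proof.
move=> mf mg; rewrite top_coefM // !big_ord_recr big_ord0 /=.
by rewrite !subnn subn0 !top_coef0 //; ring.
Qed.

Lemma top_coefM2 f g : f \is monic -> g \is monic ->
  top_coef 2 (f * g) =
    top_coef 2 f + top_coef 1 f * top_coef 1 g + top_coef 2 g.
Proof.
move=> mf mg; rewrite top_coefM // !big_ord_recr big_ord0 /=.
by rewrite !subnn subn0 !top_coef0 //; ring.
Qed.

Lemma top_coefM3 f g : f \is monic -> g \is monic ->
  top_coef 3 (f * g) = top_coef 3 f + top_coef 2 f * top_coef 1 g
    + top_coef 1 f * top_coef 2 g + top_coef 3 g.
Proof.
move=> mf mg; rewrite top_coefM // !big_ord_recr big_ord0 /=.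
by rewrite !subnn subn0 !top_coef0 //; ring.
Qed.
End TopCoefficients.

Lemma top_coef_map (A B : comNzRingType) (i : {rmorphism A -> B}) j (f : {poly A}) :
  f \is monic -> top_coef j (map_poly i f) = i (top_coef j f).
Proof.
move=> mf; rewrite /top_coef -(map_polyXn i) -rmorphM coef_map /=.
by rewrite size_map_poly_id0 // (monicP mf) rmorph1 oner_eq0.
Qed.

Section SumsOverMonicPolynomials.
Variables (K : finFieldType) (C : comNzRingType).

Lemma sum_monic_polys0 (G : {poly K} -> C) :
  \sum_(f <- monic_polys K 0) G f = G 1.
Proof.
rewrite (perm_big [:: 1]) ?big_seq1 //; apply: uniq_perm => //.
  exact: monic_polys_uniq.
move=> f; rewrite mem_monic_polys inE.
apply/andP/eqP => [[mf /eqP sf]|->]; last by rewrite monic1 size_poly1.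
have /size_poly1P[c _ Ef] : size f == 1 by rewrite sf.
by move: mf; rewrite Ef monicE lead_coefC => /eqP->.
Qed.

Lemma sum_monic_polysS (G : {poly K} -> C) n :
  \sum_(f <- monic_polys K n.+1) G f =
  \sum_(g <- monic_polys K n) \sum_c G (g * 'X + c%:P).
Proof.
rewrite -(big_allpairs_dep (h := fun g c => g * 'X + c%:P)) /=.
apply: perm_big; apply: uniq_perm; first exact: monic_polys_uniq.
  apply: allpairs_uniq; rewrite ?monic_polys_uniq ?index_enum_uniq //.
  move=> [g c] [g' c'] _ _ /= E.
  have Ec : c = c'.
    by have := congr1 (horner^~ 0) E; rewrite /= !(hornerE, mulr0, add0r).
  by move: E; rewrite Ec => /addIr/(mulIf (negbT (polyX_eq0 _)))->.
move=> f; rewrite mem_monic_polys; apply/andP/allpairsP => [|[[g c] []]].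
  case=> mf sf; move: mf sf; elim/poly_ind: f => [|g c _].
    by rewrite size_poly0.
  rewrite size_MXaddC; have [->|nzg] := eqVneq g 0.
    by rewrite size_poly0; case: (c == 0).
  move=> mf; rewrite eqSS => sg; exists (g, c); split=> //=; last first.
    by rewrite mem_index_enum.
  rewrite mem_monic_polys sg andbT monicE; move: mf.
  rewrite monicE !lead_coefE size_MXaddC (negPf nzg) /= coefD coefMX coefC.
  by rewrite -(prednK (_ : 0 < size g)%N) ?size_poly_gt0 //= addr0.
rewrite mem_monic_polys /= => /andP[mg sg] _ ->; have nzg := monic_neq0 mg.
rewrite size_MXaddC (negPf nzg) /= eqSS sg; split=> //.
rewrite monicE lead_coefE size_MXaddC (negPf nzg) /= coefD coefMX coefC.
have s0 : (0 < size g)%N by rewrite size_poly_gt0.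
by rewrite !gtn_eqF // addr0 -(monicP mg) lead_coefE.
Qed.

Variable h : K -> K -> K -> C.
Definition top_sum n : C := \sum_(f <- monic_polys K n)
  h (top_coef 1 f) (top_coef 2 f) (top_coef 3 f).

Let sum_step (G : K -> K -> K -> C) n :
  \sum_(f <- monic_polys K n.+1) G (top_coef 1 f) (top_coef 2 f) (top_coef 3 f) =
  \sum_(g <- monic_polys K n) \sum_c
     G (top_coef 1 g + if n == 0%N then c else 0)
       (top_coef 2 g + if n == 1%N then c else 0)
       (top_coef 3 g + if n == 2%N then c else 0).
Proof.
rewrite sum_monic_polysS; apply: eq_big_seq => g.
rewrite mem_monic_polys => /andP[/monic_neq0 nzg /eqP sg].
by apply: eq_bigr => c _; rewrite !top_coef_XaddC // sg !eqSS.
Qed.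

Lemma top_sum0 : top_sum 0 = h 0 0 0.
Proof. by rewrite /top_sum sum_monic_polys0 !top_coef1. Qed.

Let sum1 (G : K -> K -> K -> C) :
  \sum_(f <- monic_polys K 1) G (top_coef 1 f) (top_coef 2 f) (top_coef 3 f) =
  \sum_a G a 0 0.
Proof.
rewrite sum_step sum_monic_polys0 !top_coef1 //.
by apply: eq_bigr => a _; rewrite !add0r.
Qed.

Lemma top_sum1 : top_sum 1 = \sum_a h a 0 0.
Proof. exact: sum1. Qed.

Let sum2 (G : K -> K -> K -> C) :
  \sum_(f <- monic_polys K 2) G (top_coef 1 f) (top_coef 2 f) (top_coef 3 f) =
  \sum_a \sum_b G a b 0.
Proof.
rewrite sum_step (sum1 (fun x y z => \sum_c G (x + 0) (y + c) (z + 0))).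
by apply: eq_bigr => a _; apply: eq_bigr => b _; rewrite !addr0 add0r.
Qed.

Lemma top_sum2 : top_sum 2 = \sum_a \sum_b h a b 0.
Proof. exact: sum2. Qed.

(** From degree 3 on, a new constant coefficient does not affect the top three
    coefficients. *)
Lemma top_sum3 n :
  top_sum n.+3 = #|K|%:R ^+ n * \sum_a \sum_b \sum_c h a b c.
Proof.
elim: n => [|n IHn]; rewrite /top_sum sum_step.
  rewrite (sum2 (fun x y z => \sum_c h (x + 0) (y + 0) (z + c))) mul1r.
  by do 3![apply: eq_bigr => ? _]; rewrite !addr0 add0r.
rewrite exprS -mulrA -IHn /top_sum mulr_sumr; apply: eq_bigr => f _ /=.
by rewrite !addr0 sumr_const mulr_natl.
Qed.
End SumsOverMonicPolynomials.

Section OrderedSums.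
Variable A : nzRingType.

Lemma sum_lt2_recr n (G : nat -> nat -> A) :
  \sum_(i < n.+1) \sum_(j < n.+1 | (i < j)%N) G i j =
  \sum_(i < n) \sum_(j < n | (i < j)%N) G i j + \sum_(i < n) G i n.
Proof.
rewrite big_ord_recr /= [X in _ + X]big_pred0 ?addr0; last first.
  by move=> j; rewrite ltnNge -ltnS ltn_ord.
rewrite -big_split; apply: eq_bigr => i _ /=.
by rewrite [LHS]big_mkcond big_ord_recr /= ltn_ord -big_mkcond.
Qed.

Lemma sum_lt2_recl n (G : nat -> nat -> A) :
  \sum_(i < n.+1) \sum_(j < n.+1 | (i < j)%N) G i j =
  \sum_(j < n) G 0%N j.+1 + \sum_(i < n) \sum_(j < n | (i < j)%N) G i.+1 j.+1.
Proof.
rewrite big_ord_recl; congr (_ + _).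
  by rewrite big_mkcond big_ord_recl /= add0r.
apply: eq_bigr => i _; rewrite big_mkcond big_ord_recl /= add0r [RHS]big_mkcond.
exact: eq_bigr.
Qed.

Lemma sum_lt3_recr n (G : nat -> nat -> nat -> A) :
  \sum_(i < n.+1) \sum_(j < n.+1 | (i < j)%N) \sum_(k < n.+1 | (j < k)%N) G i j k =
  \sum_(i < n) \sum_(j < n | (i < j)%N) \sum_(k < n | (j < k)%N) G i j k
  + \sum_(i < n) \sum_(j < n | (i < j)%N) G i j n.
Proof.
rewrite (sum_lt2_recr n (fun i j => \sum_(k < n.+1 | (j < k)%N) G i j k)).
rewrite [X in _ + X]big1 ?addr0; last first.
  by move=> i _; rewrite big_pred0 // => k; rewrite ltnNge -ltnS ltn_ord.
rewrite -big_split; apply: eq_bigr => i _; rewrite -big_split.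
apply: eq_bigr => j _ /=.
by rewrite [LHS]big_mkcond big_ord_recr /= ltn_ord -big_mkcond.
Qed.
End OrderedSums.

Section ConjugateSymmetricFunctions.
Variables (K L : finFieldType) (i : {rmorphism K -> L}).
Hypothesis (q_nat : [pchar L].-nat #|K|) (char2 : 2%N \in [pchar L]).

(** No signs appear, since the characteristic is 2. *)
Lemma top_coef_conj_poly k a :
  [/\ top_coef 1 (conj_poly i k a) = T1 #|K| k a,
      top_coef 2 (conj_poly i k a) = T2 #|K| k a
    & top_coef 3 (conj_poly i k a) = T3 #|K| k a].
Proof.
rewrite /T1 /T2 /T3; elim: k => [|k [IH1 IH2 IH3]].
  by rewrite /conj_poly big_nil !big_ord0 !top_coef1.
rewrite (sum_lt2_recr k (fun l m => a ^+ (#|K| ^ l + #|K| ^ m)%N)).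
rewrite (sum_lt3_recr k (fun l m s => a ^+ (#|K| ^ l + #|K| ^ m + #|K| ^ s)%N)).
rewrite big_ord_recr /= /conj_poly trajectSr -cats1 big_cat big_seq1 /= iter_frob.
set b := a ^+ _; set g := \prod_(_ <- _) _ => /=.
have mg : g \is monic by apply: monic_prod_XsubC.
have mX : ('X - b%:P) \is monic by apply: monicXsubC.
have tX j : (0 < j <= 3)%N -> top_coef j ('X - b%:P) = if j == 1%N then b else 0.
  move=> le_j; have -> : 'X - b%:P = 1 * 'X + b%:P.
    by rewrite mul1r -polyCN oppr_pchar2.
  by rewrite top_coef_XaddC ?oner_eq0 // top_coef1 // add0r size_poly1 eq_sym.
rewrite top_coefM1 // top_coefM2 // top_coefM3 // !tX //= -/g.
rewrite [top_coef 1 g]IH1 [top_coef 2 g]IH2 [top_coef 3 g]IH3 !mulr0 !addr0.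
split=> //.
  by congr (_ + _); rewrite mulr_suml; apply: eq_bigr => j _; rewrite exprD.
congr (_ + _); rewrite mulr_suml; apply: eq_bigr => j _; rewrite mulr_suml.
by rewrite [RHS](eq_bigr _ (fun m _ => exprD _ _ _)).
Qed.

Lemma top_coef_char_poly_over k a : iter k (frob i) a = a ->
  [/\ i (top_coef 1 (char_poly_over i k a)) = T1 #|K| k a,
      i (top_coef 2 (char_poly_over i k a)) = T2 #|K| k a
    & i (top_coef 3 (char_poly_over i k a)) = T3 #|K| k a].
Proof.
move=> ka; rewrite -!top_coef_map ?char_poly_over_monic //.
by rewrite map_char_poly_over //; apply: top_coef_conj_poly.
Qed.
End ConjugateSymmetricFunctions.

(** * The binary trace *)

Section BinaryTrace.
Variables (K : finFieldType) (r : nat).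
Hypothesis (cardK : #|K| = (2 ^ r)%N).
Hypothesis (char2 : 2%N \in [pchar K]).
Implicit Types (a b x y : K).

Local Notation tr := (T1 2 r).
Local Notation tr2 := (T2 2 r).

Let sqrD x y : (x + y) ^+ 2 = x ^+ 2 + y ^+ 2.
Proof. by rewrite sqrrD -mulr_natl mulr_natl mulrn_pchar // addr0. Qed.

Let expD l x y : (x + y) ^+ (2 ^ l) = x ^+ (2 ^ l) + y ^+ (2 ^ l).
Proof. by elim: l x y => // l IHl x y; rewrite expnS !exprM sqrD IHl. Qed.

Let sqr_sum (I : Type) (s : seq I) (P : pred I) (G : I -> K) :
  (\sum_(l <- s | P l) G l) ^+ 2 = \sum_(l <- s | P l) G l ^+ 2.
Proof. by apply: (big_morph (fun x => x ^+ 2)) => [x y|]; rewrite ?sqrD ?expr0n. Qed.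

Let exp_card x : x ^+ (2 ^ r) = x.
Proof. by rewrite -cardK expf_card. Qed.

Lemma trD x y : tr (x + y) = tr x + tr y.
Proof. by rewrite /T1 -big_split; apply: eq_bigr => l _; rewrite expD. Qed.

Lemma tr0 : tr (0 : K) = 0.
Proof. by rewrite /T1 big1 // => l _; rewrite expr0n expn_eq0. Qed.

Let shift_sum (G : nat -> K) n :
  \sum_(l < n) G l.+1 + G 0%N = \sum_(l < n) G l + G n.
Proof.
transitivity (\sum_(l < n.+1) G l); last by rewrite big_ord_recr.
by rewrite big_ord_recl addrC.
Qed.

(** Frobenius permutes the conjugates of [x] cyclically; hence both [tr] and
    [tr2], which are symmetric in the conjugates, take their values in the
    prime field. *)
Lemma tr_sqr x : tr (x ^+ 2) = tr x.
Proof.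
have := shift_sum (fun l => x ^+ (2 ^ l)) r; rewrite exp_card expn0 expr1 => /addIr E.
by rewrite /T1 -E; apply: eq_bigr => l _; rewrite -exprM expnS.
Qed.

Lemma tr_sqrE x : tr x ^+ 2 = tr x.
Proof.
rewrite -[RHS]tr_sqr sqr_sum; apply: eq_bigr => l _.
by rewrite -!exprM mulnC.
Qed.

Lemma tr2_sqrE x : tr2 x ^+ 2 = tr2 x.
Proof.
pose X l := x ^+ (2 ^ l); have Xr : X r = X 0%N by rewrite /X exp_card.
have Etr2 y : tr2 y =
    \sum_(l < r) \sum_(m < r | (l < m)%N) y ^+ (2 ^ l) * y ^+ (2 ^ m).
  by apply: eq_bigr => l _; apply: eq_bigr => m _; rewrite exprD.
have -> : tr2 x ^+ 2 = \sum_(l < r) \sum_(m < r | (l < m)%N) X l.+1 * X m.+1.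
  rewrite Etr2 sqr_sum; apply: eq_bigr => l _; rewrite sqr_sum; apply: eq_bigr => m _.
  by rewrite exprMn -!exprM -!expnSr.
have := sum_lt2_recl r (fun l m => X l * X m).
rewrite (sum_lt2_recr r (fun l m => X l * X m)) -mulr_sumr -mulr_suml Xr.
have -> : \sum_(l < r) X l.+1 = tr x.
  by have := shift_sum X r; rewrite Xr => /addIr.
move=> E; apply: (addrI (X 0%N * tr x)); rewrite -E Etr2 addrC.
by rewrite [X 0%N * _]mulrC.
Qed.

(** The cross terms of [tr2 (x + y)] are all the products of a conjugate of [x]
    by a conjugate of [y], except those at equal positions. *)
Lemma tr2D x y : tr2 (x + y) = tr2 x + tr2 y + tr x * tr y + tr (x * y).
Proof.
rewrite /T1 /T2; elim: (r) => [|n IHn]; first by rewrite !big_ord0 mulr0 !addr0.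
rewrite (sum_lt2_recr n (fun l m => (x + y) ^+ (2 ^ l + 2 ^ m))).
rewrite (sum_lt2_recr n (fun l m => x ^+ (2 ^ l + 2 ^ m))).
rewrite (sum_lt2_recr n (fun l m => y ^+ (2 ^ l + 2 ^ m))) IHn.
have dist (z : K) : \sum_(l < n) z ^+ (2 ^ l + 2 ^ n)
    = (\sum_(l < n) z ^+ (2 ^ l)) * z ^+ (2 ^ n).
  by rewrite mulr_suml; apply: eq_bigr => l _; rewrite exprD.
rewrite !dist !big_ord_recr /= exprMn !expD.
have -> : \sum_(l < n) (x + y) ^+ (2 ^ l) =
    \sum_(l < n) x ^+ (2 ^ l) + \sum_(l < n) y ^+ (2 ^ l).
  by rewrite -big_split; apply: eq_bigr => l _; rewrite expD.
set A := \sum_(l < n) x ^+ _; set B := \sum_(l < n) y ^+ _.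
have two0 := two_pchar2 char2.
ring: two0.
Qed.

Let bit x : x ^+ 2 = x -> x = 0 \/ x = 1.
Proof.
move=> /eqP; rewrite -subr_eq0 -{2}[x]mulr1 -mulrBr mulf_eq0 subr_eq0.
by case/orP => /eqP->; [left|right].
Qed.

Lemma tr_bit x : tr x = 0 \/ tr x = 1. Proof. exact/bit/tr_sqrE. Qed.
Lemma tr2_bit x : tr2 x = 0 \/ tr2 x = 1. Proof. exact/bit/tr2_sqrE. Qed.

(** The trace is a nonzero polynomial of degree less than the order of [K]. *)
Lemma tr_neq0 : exists x, tr x != 0.
Proof.
apply/existsP; rewrite -negb_forall; apply/negP => /forallP tr0s.
have r_gt0 : (0 < r)%N.
  by case: r cardK => // c1; have := finNzRing_gt1 K; rewrite c1.
pose p : {poly K} := \sum_(l < r) 'X^(2 ^ l).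
have p1 : p`_1 = 1.
  rewrite coef_sum -(prednK r_gt0) big_ord_recl /= coefXn eqxx.
  rewrite big1 ?addr0 // => l _.
  by rewrite coefXn expnS mul2n; case: eqP => // /(congr1 odd); rewrite odd_double.
have nzp : p != 0.
  by apply: contraTneq (oner_neq0 K) => p0; rewrite -p1 p0 coef0 eqxx.
have sp : (size p <= (2 ^ r.-1).+1)%N.
  apply: leq_trans (size_sum _ _ _) _; apply/bigmax_leqP => l _.
  by rewrite size_polyXn ltnS leq_exp2l // -ltnS prednK.
have all_roots : all (root p) (enum K).
  apply/allP => x _; rewrite rootE horner_sum; have := tr0s x.
  by rewrite /T1; under [X in _ -> X == _]eq_bigr do rewrite hornerXn.
have := max_poly_roots nzp all_roots (enum_uniq _).
rewrite -cardE cardK; apply/negP; rewrite -leqNgt (leq_trans sp) //.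
by rewrite -{2}(prednK r_gt0) ltn_exp2l // leqnn.
Qed.
End BinaryTrace.

(** * Characters and their quadratic sums *)

Section Characters.
Variables (K : finFieldType) (r : nat) (C : numFieldType) (I : C).
Hypotheses (cardK : #|K| = (2 ^ r)%N) (char2 : 2%N \in [pchar K]).
Hypothesis (sqrI : I ^+ 2 = -1).
Implicit Types (a b c d h k s x y z : K).

Local Notation q := (#|K|%:R : C).

(** The sign [(-1)^x] for [x] in the prime field. *)
Definition bit_sign x : C := if x == 0 then 1 else -1.
Definition psi x : C := bit_sign (T1 2 r x).

(** This is [i^(T x)], where [T x] is the trace of the Teichmueller lift of [x]
    modulo 4: the value at the Witt vector [(x, 0)] of a character of order 4.
    The second symmetric function [T2] gives the second binary digit of [T x],
    which spares the construction of Witt vectors. *)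
Definition beta x : C := (if T1 2 r x == 0 then 1 else I) * bit_sign (T2 2 r x).

Let addxx := addrr_pchar2 char2.
Let eq_addK := addr_eq0_pchar2 char2.
Let eq_mod2 := eq_mod_two char2.

Lemma psiD x y : psi (x + y) = psi x * psi y.
Proof.
rewrite /psi (trD r char2) /bit_sign.
by case: (tr_bit cardK char2 x) => ->; case: (tr_bit cardK char2 y) => ->;
  rewrite ?(addr0, add0r, addxx) ?eqxx ?oner_eq0 ?(mulr1, mul1r, mulrNN).
Qed.

Lemma psi0 : psi 0 = 1. Proof. by rewrite /psi tr0 /bit_sign eqxx. Qed.

Lemma psiX x j : psi x ^+ j = psi (x *+ j).
Proof. by elim: j => [|j IHj]; rewrite ?psi0 // exprS mulrS psiD IHj. Qed.

Lemma psi_sqr x : psi (x ^+ 2) = psi x. Proof. by rewrite /psi tr_sqr. Qed.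

Lemma psi_pm x : psi x = 1 \/ psi x = -1.
Proof. by rewrite /psi /bit_sign; case: ifP; [left|right]. Qed.

Lemma psi_psi x : psi x * psi x = 1. Proof. by rewrite -psiD addxx psi0. Qed.

Lemma psi_sum c : \sum_x psi (c * x) = if c == 0 then q else 0.
Proof.
case: eqP => [->|/eqP nzc].
  by under eq_bigr do rewrite mul0r psi0; rewrite sumr_const.
have [x0 nz0] := tr_neq0 cardK.
have psi_x0 : psi (c * (c^-1 * x0)) = -1.
  by rewrite mulVKf // /psi /bit_sign (negPf nz0).
set S := \sum_x _; have ES : S = - S.
  rewrite {1}/S (reindex_inj (addIr (c^-1 * x0))) /= -mulN1r mulr_sumr.
  by apply: eq_bigr => x _; rewrite mulrDr psiD psi_x0 mulrC.
have : S *+ 2 == 0 by rewrite mulr2n {1}ES addNr.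
by rewrite mulrn_eq0 => /eqP.
Qed.

Lemma betaD x y : beta x * beta y = beta (x + y) * psi (x * y).
Proof.
rewrite /beta /psi (trD r char2) (tr2D r char2) /bit_sign.
case: (tr_bit cardK char2 x) => ->; case: (tr_bit cardK char2 y) => ->;
case: (tr2_bit cardK char2 x) => ->; case: (tr2_bit cardK char2 y) => ->;
case: (tr_bit cardK char2 (x * y)) => ->;
rewrite ?(addr0, add0r, addxx, mulr0, mul0r, mul1r, mulr1) ?eqxx ?oner_eq0 //;
rewrite ?(addr0, add0r, addxx, mulr0, mul0r, mul1r, mulr1) ?eqxx ?oner_eq0 //;
by ring: sqrI.
Qed.

Lemma beta0 : beta 0 = 1.
Proof.
rewrite /beta tr0 eqxx /T2 big1 ?/bit_sign ?eqxx ?mulr1 // => l _.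
by rewrite big1 // => m _; rewrite expr0n addn_eq0 expn_eq0.
Qed.

Lemma sqr_bij_sum (G : K -> C) : \sum_x G (x ^+ 2) = \sum_x G x.
Proof. by rewrite [RHS](reindex_inj (sqr_inj_pchar2 char2)). Qed.

(** The value on [1 + a X + b X^2 + c X^3] modulo [X^4] of the character with
    parameters [d], [h], [k]; the term [a ^+ 3 + a * b + c] is the third power
    sum in characteristic 2. *)
Definition triple_char d h k a b c : C :=
  beta (h * a) * psi (k * a + h ^+ 2 * b + d * (a ^+ 3 + a * b + c)).

Lemma triple_charM d h k a b c a' b' c' :
  triple_char d h k (a + a') (b + a * a' + b') (c + b * a' + a * b' + c') =
  triple_char d h k a b c * triple_char d h k a' b' c'.
Proof.
rewrite /triple_char [RHS]mulrACA betaD -psiD -[RHS]mulrA -psiD.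
congr (beta _ * psi _); first by ring.
apply: (eq_mod2 (z := d * (2 * a ^+ 2 * a' + 2 * a * a' ^+ 2 + a * b' + a' * b))).
ring.
Qed.

(** Summing over [k] forces [a = 0]; then [beta] disappears, and the sums over
    [h] and [d] are sums of additive characters at [b] and [c]. *)
Lemma triple_char_sum a b c :
  \sum_d \sum_h \sum_k triple_char d h k a b c =
  if [&& a == 0, b == 0 & c == 0] then q ^+ 3 else 0.
Proof.
have [-> /=|nza] := eqVneq a 0; last first.
  rewrite big1 // => d _; rewrite big1 // => h _.
  rewrite /triple_char -mulr_sumr.
  under eq_bigr => k _ do rewrite -addrA psiD [k * a]mulrC.
  by rewrite -mulr_suml psi_sum (negPf nza) mul0r mulr0.
have E d h k : triple_char d h k 0 b c = psi (b * h ^+ 2) * psi (c * d).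
  by rewrite /triple_char mulr0 beta0 mul1r -psiD; congr psi; ring.
under eq_bigr => d _ do under eq_bigr => h _ do under eq_bigr => k _ do rewrite E.
under eq_bigr => d _ do under eq_bigr => h _ do rewrite sumr_const -mulrnAl.
under eq_bigr => d _ do rewrite -mulr_suml.
rewrite -mulr_sumr psi_sum sumrMnl.
rewrite (sqr_bij_sum (fun h => psi (b * h))) psi_sum.
case: (b == 0); case: (c == 0); rewrite ?mulr0 ?mul0rn ?mul0r //=.
by rewrite -mulr_natl; ring.
Qed.

(** The value on [1 + a X]. *)
Definition cubic_char d h k a : C := beta (h * a) * psi (k * a + d * a ^+ 3).

Lemma cubic_char0 d h k : cubic_char d h k 0 = 1.
Proof. by rewrite /cubic_char mulr0 beta0 !mulr0 expr0n mulr0 addr0 psi0 mulr1. Qed.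

Lemma cubic_char_twist d h k a :
  cubic_char d h k a = cubic_char d h 0 a * psi (k * a).
Proof. by rewrite /cubic_char mul0r add0r psiD; ring. Qed.

Lemma cubic_charM d h k a b : cubic_char d h k a * cubic_char d h k b =
  cubic_char d h k (a + b) * psi (a * b * (h ^+ 2 + d * (a + b))).
Proof.
rewrite /cubic_char mulrACA betaD -psiD -[LHS]mulrA -[RHS]mulrA -!psiD.
congr (beta _ * psi _); first by ring.
by apply: (eq_mod2 (z := - (2 * d * a * b * (a + b)))); ring.
Qed.

Lemma triple_charE d h k a b : triple_char d h k a b 0 =
  cubic_char d h k a * psi ((h ^+ 2 + d * a) * b).
Proof. by rewrite /triple_char /cubic_char -mulrA -psiD; congr (_ * psi _); ring. Qed.

Definition lin_sum d h k : C := \sum_a cubic_char d h k a.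
Definition quad_sum d h k : C := \sum_a \sum_b triple_char d h k a b 0.

(** The sum over [b] selects the [a] at which the additive character of [b] is
    trivial. *)
Lemma quad_sum_neq0 d h k : d != 0 ->
  quad_sum d h k = q * cubic_char d h k (h ^+ 2 / d).
Proof.
move=> nzd; rewrite /quad_sum (bigD1 (h ^+ 2 / d)) //= [X in _ + X]big1 ?addr0.
  under eq_bigr => b _ do rewrite triple_charE.
  by rewrite -mulr_sumr psi_sum mulrCA divff // mulr1 addxx eqxx mulrC.
move=> a ne_a; under eq_bigr => b _ do rewrite triple_charE.
rewrite -mulr_sumr psi_sum eq_addK ifF ?mulr0 //.
by apply: contraNF ne_a => /eqP->; rewrite mulrC mulKf.
Qed.

Lemma quad_sum_eq0 h k : h != 0 -> quad_sum 0 h k = 0.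
Proof.
move=> nzh; rewrite /quad_sum big1 // => a _.
under eq_bigr => b _ do rewrite triple_charE.
by rewrite -mulr_sumr psi_sum mul0r addr0 expf_eq0 (negPf nzh) mulr0.
Qed.

(** The left-hand side is the sum of a nontrivial character over its group. *)
Lemma triple_char_sum3 d h k : (d != 0) || (h != 0) || (k != 0) ->
  \sum_a \sum_b \sum_c triple_char d h k a b c = 0.
Proof.
have [-> /=|nzd _] := eqVneq d 0; last first.
  rewrite big1 // => a _; rewrite big1 // => b _; rewrite /triple_char.
  under eq_bigr => c _ do rewrite mulrDr addrA psiD.
  by rewrite -!mulr_sumr psi_sum (negPf nzd) !mulr0.
have E a b c h' : triple_char 0 h' k a b c =
    beta (h' * a) * psi (k * a) * psi (h' ^+ 2 * b).
  by rewrite /triple_char mul0r addr0 psiD mulrA.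
have [-> /= nzk|nzh _] := eqVneq h 0.
  under eq_bigr => a _ do under eq_bigr => b _ do under eq_bigr => c _ do
    rewrite E mul0r beta0 mul1r expr0n mul0r psi0 mulr1.
  under eq_bigr => a _ do rewrite sumr_const sumr_const -mulrnA.
  by rewrite sumrMnl psi_sum (negPf nzk) mul0rn.
rewrite big1 // => a _; rewrite exchange_big big1 // => c _ /=.
under eq_bigr => b _ do rewrite E.
by rewrite -mulr_sumr psi_sum expf_eq0 (negPf nzh) mulr0.
Qed.

(** Write the square as a double sum over [a] and [a + s].  For fixed [s] the
    product is [cubic_char s] times an additive character of a polynomial in
    [a] of degree 2, which can be made purely quadratic because [psi] is
    invariant under Frobenius; so the sum over [a] is [q] or [0]. *)
Lemma lin_sum_sqr d h k (e := h ^+ 2) : lin_sum d h k ^+ 2 =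
  q * \sum_(s | (e + d * s) * (1 + s ^+ 2 * (e + d * s)) == 0) cubic_char d h k s.
Proof.
rewrite expr2 {1}/lin_sum mulr_suml.
under eq_bigr => a _ do rewrite mulr_sumr (reindex_inj (addrI a)) /=.
rewrite exchange_big mulr_sumr [RHS]big_mkcond; apply: eq_bigr => s _ /=.
under eq_bigr => a _ do rewrite cubic_charM addrA addxx add0r.
rewrite -mulr_sumr.
have -> : \sum_a psi (a * (a + s) * (h ^+ 2 + d * s)) =
  \sum_a psi ((e + d * s) * (1 + s ^+ 2 * (e + d * s)) * a ^+ 2).
  apply: eq_bigr => a _; have -> : a * (a + s) * (h ^+ 2 + d * s) =
    (e + d * s) * a ^+ 2 + (e + d * s) * s * a by rewrite -/e; ring.
  by rewrite psiD -[psi (_ * _ * a)]psi_sqr -psiD; congr psi; ring.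
rewrite (sqr_bij_sum (fun x => psi (_ * x))) psi_sum mulrC.
by case: ifP; rewrite ?mulr0 ?mul0r.
Qed.

(** The radical of the bilinear form whose sign is [psi] of
    [a * b * (e + d * (a + b))], see [radical_pairing]. *)
Definition radical d e a := (a == 0) || (d ^+ 2 * a ^+ 3 + e ^+ 2 * a + d == 0).

(** In this form the condition is additive in [a]. *)
Lemma radicalE d e a :
  radical d e a = (d ^+ 2 * a ^+ 4 + e ^+ 2 * a ^+ 2 + d * a == 0).
Proof.
rewrite /radical -mulf_eq0; congr (_ == 0); ring.
Qed.

Lemma radicalD d e a b : radical d e a -> radical d e (a + b) = radical d e b.
Proof.
rewrite !radicalE => /eqP Ra; congr (_ == 0).
rewrite -[RHS]add0r -Ra; apply: (eq_mod2 (z :=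
  d ^+ 2 * (2 * a ^+ 3 * b + 3 * a ^+ 2 * b ^+ 2 + 2 * a * b ^+ 3) + e ^+ 2 * a * b)).
ring.
Qed.

(** As [psi] is invariant under Frobenius, the argument can be replaced by
    [b ^+ 2] times the polynomial of [radicalE]. *)
Lemma radical_pairing d h a b : radical d (h ^+ 2) a ->
  psi (a * b * (h ^+ 2 + d * (a + b))) = 1.
Proof.
rewrite radicalE => /eqP Ra.
have -> : a * b * (h ^+ 2 + d * (a + b)) =
  (h ^+ 2 * a + d * a ^+ 2) * b + d * a * b ^+ 2 by ring.
rewrite psiD -[psi (_ * b)]psi_sqr -psiD -[RHS]psi0; congr psi.
by rewrite -[RHS](mulr0 (b ^+ 2)) -Ra; ring: (two_pchar2 char2).
Qed.

Definition radical_sum d h k : C :=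
  \sum_(a | radical d (h ^+ 2) a) cubic_char d h k a.

(** Translation by [z = h^2 / d] carries the radical to the range of summation
    in [lin_sum_sqr], and multiplies the character by its value at [z]. *)
Lemma lin_sum_sqr_neq0 d h k : d != 0 ->
  lin_sum d h k ^+ 2 = radical_sum d h k * quad_sum d h k.
Proof.
move=> nzd; rewrite lin_sum_sqr quad_sum_neq0 // mulrCA; congr (_ * _).
set z := h ^+ 2 / d; have Ez : h ^+ 2 = d * z by rewrite /z mulrCA divff ?mulr1.
have E a : ((h ^+ 2 + d * (a + z)) * (1 + (a + z) ^+ 2 * (h ^+ 2 + d * (a + z))) == 0)
    = radical d (h ^+ 2) a.
  rewrite radicalE Ez; congr (_ == 0); set v := d * z + d * (a + z).
  apply: (eq_mod2 (z := d * z + a * z * v ^+ 2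
    + (a ^+ 2 + z ^+ 2) * (2 * d * a * d * z + 2 * d ^+ 2 * z ^+ 2))).
  by rewrite /v; ring.
rewrite (reindex_inj (addIr z)) /= mulr_suml; apply: eq_big => [a|a]; first exact: E.
by rewrite E => Ra; rewrite cubic_charM radical_pairing ?mulr1.
Qed.

(** The character is multiplicative on the radical, which is a group. *)
Lemma radical_sum_sqr d h k :
  radical_sum d h k ^+ 2 = #|radical d (h ^+ 2)|%:R * radical_sum d h k.
Proof.
rewrite expr2 {1}/radical_sum mulr_suml -sum1_card natr_sum mulr_suml.
apply: eq_bigr => a Ra; rewrite mul1r mulr_sumr (reindex_inj (addrI a)) /=.
apply: eq_big => [b|b Rb]; first by rewrite radicalD.
rewrite cubic_charM radical_pairing // mulr1 addrA addxx add0r //.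
Qed.

(** The dependence on [k] is through an additive character at [a + j z], so
    the sum over [k] keeps only [a = j z], that is [a = 0] or [a = z].  All the
    totals over [k] come from this, with [P] the full set for sums containing
    [lin_sum], the radical for sums containing [radical_sum], and [{0}] for
    sums containing neither. *)
Lemma twisted_sum (P : pred K) d h z j :
  \sum_k (\sum_(a | P a) cubic_char d h k a) * cubic_char d h k z ^+ j =
  if P (z *+ j) then q * psi (h ^+ 2 * z ^+ 2) ^+ uphalf j else 0.
Proof.
set f := cubic_char d h 0.
have fz2 : f z ^+ 2 = psi (h ^+ 2 * z ^+ 2).
  by rewrite expr2 cubic_charM addxx cubic_char0 mul1r; congr psi; ring.
have -> : \sum_k (\sum_(a | P a) cubic_char d h k a) * cubic_char d h k z ^+ j =
  \sum_(a | P a) f a * f z ^+ j * \sum_k psi ((a + z *+ j) * k).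
  under eq_bigr => k _ do rewrite mulr_suml.
  rewrite exchange_big; apply: eq_bigr => a Pa; rewrite mulr_sumr.
  apply: eq_bigr => k _; rewrite !(cubic_char_twist d h k) exprMn.
  rewrite psiX mulrDl psiD -mulrnAr [a * k]mulrC [z *+ j * k]mulrC -/f; ring.
under eq_bigr => a _ do rewrite psi_sum eq_addK.
have Ef : f (z *+ j) * f z ^+ j = psi (h ^+ 2 * z ^+ 2) ^+ uphalf j.
  have -> : f (z *+ j) = f z ^+ odd j.
    by rewrite mulrn_odd; case: (odd j); rewrite ?expr1 // /f cubic_char0.
  rewrite -fz2 -exprM -exprD; congr (_ ^+ _).
  by rewrite uphalf_half -{2}(odd_double_half j); lia.
case: ifP => Pz.
  rewrite (bigD1 (z *+ j)) //= eqxx Ef big1 ?addr0 1?mulrC // => a /andP[_ /negPf->].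
  by rewrite mulr0.
rewrite big1 // => a Pa; case: eqP => [Ea|_]; last by rewrite mulr0.
by move: Pz; rewrite -Ea Pa.
Qed.
End Characters.

(** * Power sums attached to a character *)

Section PowerSums.
Variable C : comNzRingType.

(** If [c1 ^+ 2 = rho * c2], then up to sign and powers of [c1] and [c2] the
    sums of powers of the two roots of [X^2 + c1 X + c2] only depend on [rho].
    A pair holds the factors of the powers [2 j] and [2 j + 1]. *)
Definition lucas_step (rho : C) (p : C * C) :=
  (rho * p.2 - p.1, rho * p.2 - p.1 - p.2).
Definition lucas rho j := iter j (lucas_step rho) (2, 1).

(** The value [-2] at [0] extends the recurrence, which only holds from the third
    term on, to the second one. *)
Lemma lucas_recurrence (S : nat -> C) (c1 c2 rho : C) N j :
  S 0%N = - 2 -> S 1%N = c1 -> c1 ^+ 2 = rho * c2 ->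
  (forall m, (m.+2 <= N)%N -> S m.+2 = - c1 * S m.+1 - c2 * S m) ->
  ((j.*2 <= N)%N -> S j.*2 = - c2 ^+ j * (lucas rho j).1) /\
  ((j.*2.+1 <= N)%N -> S j.*2.+1 = c1 * c2 ^+ j * (lucas rho j).2).
Proof.
move=> S0 S1 c1E rec; elim: j => [|j [IHe IHo]].
  by rewrite S0 S1 /=; split=> _; ring.
have even_step : (j.+1.*2 <= N)%N -> S j.+1.*2 = - c2 ^+ j.+1 * (lucas rho j.+1).1.
  rewrite doubleS => le_N; rewrite rec // IHo ?IHe; try lia.
  rewrite /= exprS -/(lucas rho j).
  have -> : - c1 * (c1 * c2 ^+ j * (lucas rho j).2) =
    - (c1 ^+ 2 * c2 ^+ j * (lucas rho j).2) by ring.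
  by rewrite c1E; ring.
split=> // le_N; rewrite doubleS rec -?doubleS; try lia.
rewrite even_step; last lia.
rewrite IHo; last lia.
by rewrite /= exprS -/(lucas rho j); ring.
Qed.
End PowerSums.

Section CharacterTotals.
Variables (K L : finFieldType) (i : {rmorphism K -> L}) (r N : nat).
Variables (C : numFieldType) (I : C).
Hypotheses (cardK : #|K| = (2 ^ r)%N) (sqrI : I ^+ 2 = -1).
Hypotheses (char2 : 2%N \in [pchar K]) (q_nat : [pchar L].-nat #|K|).
Hypothesis splits : forall f : {poly K}, f \is monic -> (size f <= N.+1)%N ->
  exists s, map_poly i f = \prod_(x <- s) ('X - x%:P).
Hypothesis N_ge3 : (3 <= N)%N.
Implicit Types (d h k : K).

Local Notation q := (#|K|%:R : C).
Local Notation psi := (@psi K r C).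
Local Notation f_ := (@cubic_char K r C I).
Local Notation c1 := (@lin_sum K r C I).
Local Notation c2 := (@quad_sum K r C I).

Definition poly_char d h k (f : {poly K}) : C :=
  triple_char r I d h k (top_coef 1 f) (top_coef 2 f) (top_coef 3 f).

Lemma poly_charM d h k f g : f \is monic -> g \is monic ->
  poly_char d h k (f * g) = poly_char d h k f * poly_char d h k g.
Proof.
move=> mf mg.
by rewrite /poly_char top_coefM1 // top_coefM2 // top_coefM3 // triple_charM.
Qed.

Definition char_sum d h k n : C := point_sum i (poly_char d h k) n.

Section NontrivialCharacter.
Variables (d h k : K).
Hypothesis nontrivial : (d != 0) || (h != 0) || (k != 0).
Local Notation S := (char_sum d h k).
Local Notation M := (poly_sum (poly_char d h k)).

Let M0 : M 0 = 1.
Proof.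
by rewrite [M 0]top_sum0 /triple_char !mulr0 beta0 !(mulr0, expr0n, addr0) psi0 mulr1.
Qed.

Let M1 : M 1 = c1 d h k.
Proof.
rewrite [M 1]top_sum1; apply: eq_bigr => a _.
by rewrite triple_charE // mulr0 psi0 mulr1.
Qed.

Let M2 : M 2 = c2 d h k. Proof. exact: top_sum2. Qed.

Let M3 n : M n.+3 = 0.
Proof. by rewrite [M _]top_sum3 triple_char_sum3 // mulr0. Qed.

Let newton n : (n <= N)%N ->
  n%:R * M n = \sum_(1 <= m < n.+1) S m * M (n - m).
Proof.
move=> le_nN; apply: newton_identity => //; first exact: poly_charM.
by move=> f mf sf; apply: splits => //; apply: leq_trans sf _.
Qed.

Lemma char_sum1 : (1 <= N)%N -> S 1 = c1 d h k.
Proof. by move/newton; rewrite mul1r big_nat1 M1 M0 mulr1. Qed.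

Lemma char_sum2 : (2 <= N)%N -> S 2 = 2 * c2 d h k - c1 d h k ^+ 2.
Proof.
move=> le2; have := newton le2; rewrite big_nat_recr //= big_nat1 M2 M1 M0 mulr1.
by rewrite char_sum1 ?(ltnW le2) // => ->; ring.
Qed.

(** The L-series is [1 + c1 u + c2 u^2]: in [newton] only three terms remain. *)
Lemma char_sum3 n : (n.+3 <= N)%N ->
  S n.+3 = - c1 d h k * S n.+2 - c2 d h k * S n.+1.
Proof.
move=> le_nN; have := newton le_nN; rewrite M3 mulr0.
rewrite 3?big_nat_recr //= subnn subSnn.
have -> : (n.+3 - n.+1 = 2)%N by lia.
rewrite M0 M1 M2 big_nat_cond big1 ?add0r => [E|m]; last first.
  case/andP=> /andP[_ lt_m] _; have -> : (n.+3 - m = (n - m).+3)%N by lia.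
  by rewrite M3 mulr0.
by apply/eqP; rewrite -subr_eq0 [X in _ == X]E; apply/eqP; ring.
Qed.

Lemma char_sum_lucas rho j : c1 d h k ^+ 2 = rho * c2 d h k -> (0 < j)%N ->
  ((j.*2 <= N)%N -> S j.*2 = - c2 d h k ^+ j * (lucas rho j).1) /\
  ((j.*2.+1 <= N)%N -> S j.*2.+1 = c1 d h k * c2 d h k ^+ j * (lucas rho j).2).
Proof.
move=> c1E j_gt0; pose S' n := if n == 0%N then - 2 else S n.
have S1 : S' 1%N = c1 d h k by rewrite /S' char_sum1 // (leq_trans _ N_ge3).
have rec m : (m.+2 <= N)%N -> S' m.+2 = - c1 d h k * S' m.+1 - c2 d h k * S' m.
  case: m => [|m] le_m; last by rewrite /S' char_sum3.
  by rewrite /S' /= char_sum2 // char_sum1 ?(leq_trans _ N_ge3) //; ring.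
have [even_eq odd_eq] := lucas_recurrence j (erefl : S' 0%N = _) S1 c1E rec.
by split=> // le_N; rewrite -even_eq // /S' double_eq0 gtn_eqF.
Qed.
End NontrivialCharacter.

Definition char_total d h n : C := \sum_k char_sum d h k n.

Lemma char_total_00 n : (0 < n <= N)%N ->
  char_total 0 0 n = #|[set a : L | iter n (frob i) a == a]|%:R.
Proof.
move=> /andP[n_gt0 le_nN]; rewrite /char_total (bigD1 0) //= [X in _ + X]big1 ?addr0.
  rewrite /char_sum /point_sum -sum1_card natr_sum; apply: eq_big => a.
    by rewrite inE.
  by rewrite /poly_char /triple_char !mul0r beta0 expr0n mul0r !addr0 psi0 mulr1.
move=> k nzk.
have c1_0 : c1 0 0 k = 0.
  rewrite /lin_sum -[RHS](_ : \sum_a psi (k * a) = 0); last first.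
    by rewrite psi_sum // (negPf nzk).
  by apply: eq_bigr => a _; rewrite /cubic_char !mul0r beta0 mul1r addr0.
have c2_0 : c2 0 0 k = 0.
  rewrite /quad_sum exchange_big big1 // => b _; rewrite -[RHS]c1_0.
  apply: eq_bigr => a _; rewrite triple_charE // expr0n mul0r addr0 mul0r.
  by rewrite psi0 mulr1.
have nt : ((0 : K) != 0) || ((0 : K) != 0) || (k != 0) by rewrite nzk !orbT.
case: n n_gt0 le_nN => // -[|[|n]] _ le_nN.
- by rewrite char_sum1 ?c1_0.
- by rewrite char_sum2 // c1_0 c2_0 mulr0 expr0n subr0.
by rewrite char_sum3 // c1_0 c2_0 oppr0 !mul0r subr0.
Qed.

(** Here [c2 = 0]: the sum over the points is minus a power of [- c1]. *)
Lemma char_total_d0 h j : h != 0 -> (0 < j)%N ->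
  ((j.*2 <= N)%N -> char_total 0 h j.*2 =
     if odd j then 0 else - (q ^+ j.+1 * psi 1 ^+ uphalf j)) /\
  ((j.*2.+1 <= N)%N -> char_total 0 h j.*2.+1 = q ^+ j.+1 * psi 1 ^+ uphalf j).
Proof.
move=> nzh j_gt0; pose z := h^-1.
have hz : h ^+ 2 * z ^+ 2 = 1 by rewrite -exprMn mulfV ?expr1n.
have c1E k : c1 0 h k ^+ 2 = q * f_ 0 h k z.
  rewrite lin_sum_sqr //; congr (_ * _); apply: big_pred1 => s.
  rewrite /= mul0r addr0 mulf_eq0 expf_eq0 (negPf nzh) /= addr_eq0 oppr_pchar2 //.
  rewrite -exprMn eq_sym sqrf_eq1 oppr_pchar2 // orbb.
  by rewrite -[RHS](inj_eq (mulIf nzh)) mulVf.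
have ntr k : ((0 : K) != 0) || (h != 0) || (k != 0) by rewrite nzh orbT.
have rec k m : (m.+1 <= N)%N -> char_sum 0 h k m.+1 = c1 0 h k * (- c1 0 h k) ^+ m.
  elim: m => [|m IHm] le_mN; first by rewrite char_sum1 // mulr1.
  case: m IHm le_mN => [|m] IHm le_mN.
    by rewrite char_sum2 // quad_sum_eq0 //; ring.
  rewrite char_sum3 // quad_sum_eq0 // IHm ?(ltnW le_mN) // mul0r subr0.
  by rewrite [in RHS]exprS; ring.
have tw P := twisted_sum cardK char2 sqrI P 0 h z j.
split=> le_N.
  have -> : char_total 0 h j.*2 = - q ^+ j *
      \sum_k (\sum_(a | pred1 0 a) f_ 0 h k a) * f_ 0 h k z ^+ j.
    rewrite mulr_sumr; apply: eq_bigr => k _.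
    rewrite (big_pred1 0) // cubic_char0 // mul1r.
    case: j j_gt0 le_N {tw} => // m _; rewrite doubleS => le_N.
    rewrite rec // exprS -mul2n exprM sqrrN [RHS]mulNr -exprMn -c1E.
    by rewrite [RHS](congr1 _ (exprS _ _)); ring.
  rewrite tw /= (mulrn_odd char2) hz.
  have nzz : (z == 0) = false by rewrite invr_eq0 (negPf nzh).
  by case: (odd j); rewrite ?nzz ?eqxx ?mulr0 // exprSr; ring.
have -> : char_total 0 h j.*2.+1 = q ^+ j *
    \sum_k (\sum_(a | predT a) f_ 0 h k a) * f_ 0 h k z ^+ j.
  rewrite mulr_sumr; apply: eq_bigr => k _; rewrite rec // -mul2n exprM sqrrN c1E.
  by rewrite exprMn -[\sum_(a | _) _]/(c1 0 h k); ring.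
by rewrite tw hz /= exprSr; ring.
Qed.

(** For odd exponents the factor [c1] vanishes unless [rho] equals the order
    [R] of the radical.  For even ones the value is interpolated linearly
    between [rho = 0] and [rho = R]. *)
Lemma char_total_d d h j (e := h ^+ 2) (R := #|radical d e|%:R : C)
    (sigma := psi (e * (e / d) ^+ 2)) : d != 0 -> (0 < j)%N ->
  ((j.*2 <= N)%N -> char_total d h j.*2 =
     if odd j && (h != 0) then 0 else - (q ^+ j.+1 * sigma ^+ uphalf j *
       ((lucas 0 j).1 + ((lucas R j).1 - (lucas 0 j).1) / R))) /\
  ((j.*2.+1 <= N)%N -> char_total d h j.*2.+1 =
     q ^+ j.+1 * sigma ^+ uphalf j * (lucas R j).2).
Proof.
move=> nzd j_gt0; pose z := e / d; pose rho := radical_sum r I d h.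
have nzR : R != 0.
  rewrite pnatr_eq0 -lt0n; apply/card_gt0P; exists 0.
  by rewrite unfold_in /radical eqxx.
have rho2 k : rho k ^+ 2 = R * rho k by apply: radical_sum_sqr.
have c1E k : c1 d h k ^+ 2 = rho k * c2 d h k by apply: lin_sum_sqr_neq0.
have c2E k : c2 d h k = q * f_ d h k z by apply: quad_sum_neq0.
have rho01 k : rho k = 0 \/ rho k = R.
  have /eqP := rho2 k; rewrite expr2 -subr_eq0 -mulrBl mulf_eq0 subr_eq0.
  by case/orP => /eqP->; [right|left].
have ntr k : (d != 0) || (h != 0) || (k != 0) by rewrite nzd.
have z0 : (z == 0) = (h == 0).
  by rewrite mulf_eq0 invr_eq0 (negPf nzd) orbF expf_eq0.
have zj0 : (z *+ j == 0) = ~~ (odd j && (h != 0)).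
  by rewrite (mulrn_odd char2) -z0; case: (odd j); rewrite ?eqxx ?negbK.
have Rz : radical d e (z *+ j) = ~~ (odd j && (h != 0)).
  rewrite -zj0 /radical (mulrn_odd char2); case: (odd j); rewrite ?eqxx //.
  have -> : d ^+ 2 * z ^+ 3 + e ^+ 2 * z + d = d.
    have -> : e = d * z by rewrite /z mulrCA divff ?mulr1.
    have -> : d ^+ 2 * z ^+ 3 + (d * z) ^+ 2 * z + d = d ^+ 2 * z ^+ 3 *+ 2 + d by ring.
    by rewrite (mulrn_odd char2) add0r.
  by rewrite (negPf nzd) orbF.
have tw P := twisted_sum cardK char2 sqrI P d h z j.
split=> le_N.
  have -> : char_total d h j.*2 = - q ^+ j * (
      (lucas 0 j).1 * \sum_k (\sum_(a | pred1 0 a) f_ d h k a) * f_ d h k z ^+ j +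
      ((lucas R j).1 - (lucas 0 j).1) / R * 
        \sum_k (\sum_(a | radical d e a) f_ d h k a) * f_ d h k z ^+ j).
    rewrite !mulr_sumr -big_split mulr_sumr; apply: eq_bigr => k _ /=.
    have [/(_ le_N)-> _] := char_sum_lucas (ntr k) (c1E k) j_gt0.
    rewrite (big_pred1 0) // cubic_char0 // -[\sum_(a | _) _]/(rho k) c2E exprMn.
    by case: (rho01 k) => ->; field.
  rewrite !tw /= zj0 Rz; case: (odd j && (h != 0)) => /=.
    by rewrite !mulr0 addr0 mulr0.
  by rewrite -/sigma exprSr; ring.
have -> : char_total d h j.*2.+1 = q ^+ j * (lucas R j).2 *
    \sum_k (\sum_(a | predT a) f_ d h k a) * f_ d h k z ^+ j.
  rewrite mulr_sumr; apply: eq_bigr => k _.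
  have [_ /(_ le_N)->] := char_sum_lucas (ntr k) (c1E k) j_gt0.
  rewrite c2E exprMn -[X in _ * (X * _)]/(c1 d h k).
  case: (rho01 k) => E; last by rewrite E; ring.
  have /eqP := c1E k; rewrite E mul0r expf_eq0 /= => /eqP->; ring.
by rewrite tw -/sigma /= exprSr; ring.
Qed.
End CharacterTotals.

(** * Statistics of the radical *)

Section RadicalStatistics.
Variables (K : finFieldType) (r : nat) (C : numFieldType).
Hypotheses (cardK : #|K| = (2 ^ r)%N) (char2 : 2%N \in [pchar K]).
Implicit Types (a d e u x y : K).

Local Notation q := (#|K|%:R : C).
Local Notation psi := (@psi K r C).
Local Notation e1 := (psi 1).

Let addxx := addrr_pchar2 char2.
Let eq_addK := addr_eq0_pchar2 char2.
Let eq_mod2 := eq_mod_two char2.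
Let nzq : q != 0.
Proof. by rewrite cardK pnatr_eq0 expn_eq0. Qed.

Lemma psi_artin_schreier v : psi (v + v ^+ 2) = 1.
Proof. by rewrite psiD // psi_sqr // psi_psi. Qed.

(** Detect the equation by the additive characters [psi (x * _)]: their sum over
    [y] vanishes unless [x + x^2 = 0], that is [x = 0] or [x = 1]. *)
Lemma card_artin_schreier u : (#|[pred y | y ^+ 2 + y == u]|)%:R = 1 + psi u.
Proof.
rewrite -sum1_card natr_sum; apply: (mulfI nzq); rewrite mulr_sumr big_mkcond.
transitivity (\sum_y \sum_x psi ((y ^+ 2 + y + u) * x)).
  by apply: eq_bigr => y _; rewrite psi_sum // mulr1 eq_addK.
rewrite exchange_big /=.
transitivity (\sum_x psi (u * x) * \sum_y psi ((x + x ^+ 2) * y)).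
  apply: eq_bigr => x _; rewrite -(sqr_bij_sum _ (fun y => psi (_ * y))) //.
  rewrite mulr_sumr; apply: eq_bigr => y _.
  rewrite mulrDl psiD // mulrC mulrDl psiD // -[psi (y * x)](psi_sqr _ cardK).
  by rewrite -psiD //; congr (_ * psi _); ring.
under eq_bigr => x _ do rewrite psi_sum // eq_addK.
rewrite (bigD1 0) //= (bigD1 1) ?oner_eq0 //= big1 ?addr0 => [|x /andP[nz0 nz1]].
  by rewrite mulr0 psi0 expr0n expr1n !eqxx mulr1; ring.
case: eqP => [E|_]; last by rewrite mulr0.
case/negP: nz1; apply/eqP; by apply: (mulfI nz0); rewrite mulr1 -expr2 -E.
Qed.

Lemma bij_sum_neq0 (g : K -> K) (x0 : K) (G : K -> C) : injective g -> g x0 = x0 ->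
  \sum_(x | x != x0) G (g x) = \sum_(x | x != x0) G x.
Proof.
move=> g_inj g0; rewrite [RHS](reindex_inj g_inj) /=; apply: eq_bigl => x.
by rewrite -{2}g0 (inj_eq g_inj).
Qed.

Lemma psi_sum_neq0 c : c != 0 -> \sum_(x | x != 0) psi (c * x) = -1.
Proof.
move=> nzc; have := psi_sum C cardK char2 c; rewrite (negPf nzc) (bigD1 0) //=.
by rewrite mulr0 psi0 => /eqP; rewrite addrC addr_eq0 => /eqP.
Qed.

Definition cubic_root d e a := d ^+ 2 * a ^+ 3 + e ^+ 2 * a + d == 0.
Local Notation N d e := (#|cubic_root d e|%:R : C).

Lemma card_radical d e : d != 0 -> #|radical d e|%:R = 1 + N d e.
Proof.
move=> nzd; rewrite (cardD1 0) {1}/radical unfold_in eqxx natrD; congr (_ + _%:R).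
apply: eq_card => a; rewrite !inE unfold_in /radical /cubic_root unfold_in.
have [->|_] //= := eqVneq a 0; rewrite expr0n !mulr0 !add0r.
by rewrite (negPf nzd).
Qed.

(** With [u = e / (d a)] the equation of the cubic becomes
    [1 + u^2 = 1 / (d a^3)], so that [e^3 / d^2 = u^3 / (1 + u)^2], which equals
    [u + v + v^2] for [v = u / (1 + u)]. *)
Lemma psi_cubic_root d e a : d != 0 -> cubic_root d e a ->
  a != 0 /\ psi (e * (e / d) ^+ 2) = psi (1 + (d * a ^+ 3)^-1).
Proof.
move=> nzd /eqP Ra.
have nza : a != 0.
  by apply: contra_eq_neq Ra => ->; rewrite expr0n !mulr0 !add0r.
split=> //; pose u := e / (d * a).
have u2 : 1 + u ^+ 2 = (d * a ^+ 3)^-1.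
  have : (1 + u ^+ 2) * (d ^+ 2 * a ^+ 3) = d.
    have -> : (1 + u ^+ 2) * (d ^+ 2 * a ^+ 3) = d ^+ 2 * a ^+ 3 + e ^+ 2 * a.
      by rewrite /u; field; rewrite nza nzd.
    by apply/eqP; rewrite -eq_addK; apply/eqP.
  move=> E; apply: (mulIf (_ : d ^+ 2 * a ^+ 3 != 0)).
    by rewrite mulf_eq0 !expf_eq0 /= (negPf nza) (negPf nzd).
  by rewrite E; field; rewrite nza nzd.
have nzu : 1 + u != 0.
  have : 1 + u ^+ 2 != 0.
    by rewrite u2 invr_eq0 mulf_eq0 expf_eq0 /= (negPf nza) (negPf nzd).
  apply: contra_neq => E; have -> : u = 1 by apply/eqP; rewrite eq_sym -eq_addK E.
  by rewrite expr1n addxx.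
pose v := u / (1 + u).
have -> : e * (e / d) ^+ 2 = u + (v + v ^+ 2).
  have -> : e * (e / d) ^+ 2 = u ^+ 3 * (d * a ^+ 3).
    by rewrite /u; field; rewrite nza nzd.
  rewrite -[d * _]invrK -u2.
  have -> : 1 + u ^+ 2 = (1 + u) ^+ 2 by apply/esym/(eq_mod2 (z := u)); ring.
  apply: (eq_mod2 (z := - (u + 2 * u ^+ 2) / (1 + u) ^+ 2)).
  by rewrite /v; field.
rewrite psiD // psi_artin_schreier mulr1 -u2 -[psi u](psi_sqr _ cardK).
by rewrite addrA addxx add0r.
Qed.

(** Divide the cubic by the factor of a known root [a]: the other roots [a y]
    satisfy [y^2 + y = 1 / (d a^3)], an equation whose solvability is expressed
    by [psi_cubic_root]. *)
Lemma card_cubic_root d e a (sigma := psi (e * (e / d) ^+ 2)) : d != 0 ->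
  cubic_root d e a -> N d e = 2 + e1 * sigma.
Proof.
move=> nzd Ra; have [nza Es] := psi_cubic_root nzd Ra.
pose u := (d * a ^+ 3)^-1.
have nzu : u != 0.
  by rewrite invr_eq0 mulf_eq0 expf_eq0 /= (negPf nza) (negPf nzd).
have eE : e ^+ 2 = d / a + d ^+ 2 * a ^+ 2.
  apply: (mulIf nza); apply/eqP; rewrite -eq_addK.
  have -> : e ^+ 2 * a + (d / a + d ^+ 2 * a ^+ 2) * a =
    d ^+ 2 * a ^+ 3 + e ^+ 2 * a + d by field.
  exact: Ra.
have EN : N d e = \sum_(y | (y == 1) || (y ^+ 2 + y == u)) 1.
  rewrite -sum1_card natr_sum (reindex_inj (mulfI nza)) /=; apply: eq_bigl => y.
  rewrite unfold_in /cubic_root eE -(eq_addK y) -(eq_addK _ u) -mulf_eq0.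
  have -> : d ^+ 2 * (a * y) ^+ 3 + (d / a + d ^+ 2 * a ^+ 2) * (a * y) + d =
    (d ^+ 2 * a ^+ 3) * ((y + 1) * (y ^+ 2 + y + u)).
    apply: (eq_mod2 (z := - d ^+ 2 * a ^+ 3 * y ^+ 2)).
    by rewrite /u; field; rewrite nza nzd.
  have nzc : d ^+ 2 * a ^+ 3 != 0.
    by rewrite mulf_eq0 !expf_eq0 /= (negPf nza) (negPf nzd).
  by rewrite [LHS]mulf_eq0 (negPf nzc).
have -> : sigma = psi (1 + u) by [].
rewrite psiD // mulrA psi_psi // mul1r EN (bigD1 1) ?eqxx //=.
have -> : 2 + psi u = 1 + (1 + psi u) by ring.
rewrite -card_artin_schreier -sum1_card natr_sum; congr (_ + _).
apply: eq_bigl => y; rewrite inE; have [->|] //= := eqVneq y 1.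
  by rewrite expr1n addxx eq_sym (negPf nzu).
by rewrite andbT.
Qed.

(** For fixed [a] put [d = y / a^3]: the equation becomes
    [(e a^2)^2 = y^2 + y], and for fixed [y] other than [0] and [1] it has
    exactly one nonzero solution [a], since squaring is bijective. *)
Lemma cubic_root_sum e (G : K -> C) : e != 0 ->
  \sum_(d | d != 0) \sum_(a | cubic_root d e a) G (d * a ^+ 3) =
  \sum_(y | (y != 0) && (y != 1)) G y.
Proof.
move=> nze.
transitivity (\sum_(a | a != 0)
    \sum_(y | (y != 0) && ((e * a ^+ 2) ^+ 2 == y ^+ 2 + y)) G y).
  rewrite (exchange_big_dep (fun a => a != 0)) /=; last first.
    by move=> d a nzd /(psi_cubic_root nzd)[].
  apply: eq_bigr => a nza.
  have nza3 : (a ^+ 3)^-1 != 0 by rewrite invr_eq0 expf_eq0.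
  rewrite (reindex_inj (mulIf nza3)) /=; apply: eq_big => y; last first.
    by rewrite mulfVK ?expf_eq0.
  rewrite mulf_eq0 (negPf nza3) orbF; congr (_ && _).
  rewrite /cubic_root -(eq_addK _ (y ^+ 2 + y)).
  have -> : (y / a ^+ 3) ^+ 2 * a ^+ 3 + e ^+ 2 * a + y / a ^+ 3 =
    ((e * a ^+ 2) ^+ 2 + (y ^+ 2 + y)) / a ^+ 3 by field.
  by rewrite mulf_eq0 (negPf nza3) orbF.
rewrite (exchange_big_dep (fun y => y != 0)) /=; last by move=> a y _ /andP[].
rewrite big_mkcondr; apply: eq_bigr => y nzy.
have inj_g : injective (fun a : K => (e * a ^+ 2) ^+ 2).
  by move=> a b /(sqr_inj_pchar2 char2)/(mulfI nze)/(sqr_inj_pchar2 char2).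
transitivity (\sum_(x | (x != 0) && (x == y ^+ 2 + y)) G y).
  rewrite [RHS](reindex_inj inj_g) /=; apply: eq_bigl => a.
  by rewrite !expf_eq0 mulf_eq0 expf_eq0 /= (negPf nze) nzy.
have -> : y ^+ 2 + y = y * (y + 1) by ring.
have [->|ny1] /= := eqVneq y 1.
  by rewrite addxx mulr0 big_pred0 // => x; case: eqP.
rewrite (big_pred1 (y * (y + 1))) // => x /=; case: eqP => //= ->.
by rewrite eq_sym mulf_eq0 (negPf nzy) eq_addK (negPf ny1).
Qed.

Lemma sum_card_cubic_root e : e != 0 -> \sum_(d | d != 0) N d e = q - 2.
Proof.
move=> nze; transitivity (\sum_(y : K | (y != 0) && (y != 1)) (1 : C)).
  rewrite -(cubic_root_sum (fun=> 1) nze); apply: eq_bigr => d _.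
  by rewrite -sum1_card natr_sum.
have : \sum_(y : K) (1 : C) = q by rewrite sumr_const.
by rewrite (bigD1 0) //= (bigD1 1) ?oner_eq0 //= => <-; ring.
Qed.

Lemma sum_card_cubic_root_sign e : e != 0 ->
  \sum_(d | d != 0) N d e * psi (e * (e / d) ^+ 2) = - 1 - e1.
Proof.
move=> nze; transitivity (\sum_(y | (y != 0) && (y != 1)) psi (1 + y^-1)).
  rewrite -(cubic_root_sum (fun y => psi (1 + y^-1)) nze); apply: eq_bigr => d nzd.
  rewrite -sum1_card natr_sum mulr_suml; apply: eq_bigr => a Ra.
  by have [_ ->] := psi_cubic_root nzd Ra; rewrite mul1r.
have : \sum_(y | y != 0) psi (1 + y^-1) = - e1.
  under eq_bigr => y _ do rewrite psiD //.
  rewrite -mulr_sumr (bij_sum_neq0 (g := fun y => y^-1) (x0 := 0) psi) ?invr0 //.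
    have := psi_sum_neq0 (oner_neq0 K); under eq_bigr do rewrite mul1r.
    by move=> ->; rewrite mulrN1.
  exact: invr_inj.
rewrite (bigD1 1) ?oner_eq0 //= invr1 addxx psi0 => <-; ring.
Qed.

Lemma sum_sign e : e != 0 -> \sum_(d | d != 0) psi (e * (e / d) ^+ 2) = -1.
Proof.
move=> nze; rewrite -[RHS](psi_sum_neq0 nze).
rewrite -[RHS](bij_sum_neq0 (g := fun d => (e / d) ^+ 2) (x0 := 0)) //.
  by move=> x y /(sqr_inj_pchar2 char2)/(mulfI nze)/invr_inj.
by rewrite invr0 mulr0 expr0n.
Qed.

(** Let [s] be the sign and [N] the number of roots of the cubic, which is [0]
    or [2 + e1 * s].  If [s = - e1], then [N] is at most 1; the three preceding
    sums show that it is 1 on average, so it is always 1.  If [s = e1], then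
    [N] is 0 or 3.  Thus [G] can be written as a linear combination of [1], [s],
    [N] and [N * s], and its sum follows. *)
Lemma radical_statistics e (G : C -> C -> C) : e != 0 ->
  \sum_(d | d != 0) G #|radical d e|%:R (psi (e * (e / d) ^+ 2)) =
  (q - 1 + e1) / 2 * G 2 (- e1) + (q - 3 - e1) / 6 * G 4 e1 + (q - e1) / 3 * G 1 e1.
Proof.
move=> nze; pose s d := psi (e * (e / d) ^+ 2).
have e1e1 : e1 * e1 = 1 by apply: psi_psi.
have sv d : s d = e1 \/ s d = - e1.
  by rewrite /s; case: (psi_pm r C (e * (e / d) ^+ 2)) => ->;
    case: (psi_pm r C (1 : K)) => ->; rewrite ?opprK; auto.
have NV d : d != 0 -> N d e = 0 \/ N d e = 2 + e1 * s d.
  move=> nzd; have [/existsP[a Ra]|no] := boolP [exists a, cubic_root d e a].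
    by right; apply: card_cubic_root Ra.
  left; rewrite eq_card0 // => a; apply/negP => Ra; case/negP: no.
  by apply/existsP; exists a.
have Nodd d : d != 0 -> s d = - e1 -> N d e = 1.
  have terms d' : d' != 0 -> 0 <= (1 - e1 * s d') * (1 - N d' e).
    move=> nzd'; case: (sv d') => E; first by rewrite E e1e1 subrr mul0r.
    case: (NV d' nzd') => ->; rewrite E mulrN e1e1 opprK.
      by rewrite subr0 mulr1 addr_ge0.
    have -> : (1 + 1) * (1 - (2 - 1)) = 0 :> C by ring.
    by [].
  have : \sum_(d | d != 0) (1 - e1 * s d) * (1 - N d e) = 0.
    have -> : \sum_(d | d != 0) (1 - e1 * s d) * (1 - N d e) =
      \sum_(d : K | d != 0) 1 - e1 * \sum_(d | d != 0) s d - \sum_(d | d != 0) N d e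
      + e1 * \sum_(d | d != 0) N d e * s d.
      rewrite !mulr_sumr -!sumrB -big_split; apply: eq_bigr => ? _ /=; ring.
    rewrite sum_sign // sum_card_cubic_root // sum_card_cubic_root_sign //.
    have : \sum_(y : K) (1 : C) = q by rewrite sumr_const.
    rewrite (bigD1 0) //= => <-; ring: e1e1.
  move=> sum0 nzd Es; have := psumr_eq0P terms sum0 nzd; rewrite Es mulrN e1e1 opprK.
  by move/eqP; rewrite mulf_eq0 -(natrD _ 1 1) pnatr_eq0 /= subr_eq0 => /eqP.
transitivity (\sum_(d | d != 0) ((1 - e1 * s d) / 2 * G 2 (- e1) +
   (1 + e1 * s d) / 2 * (N d e / 3 * G 4 e1 + (1 - N d e / 3) * G 1 e1))).
  apply: eq_bigr => d nzd; rewrite card_radical // -/(s d).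
  case: (sv d) => E; last first.
    rewrite Nodd // E mulrN e1e1 opprK subrr mul0r mul0r addr0 -(natrD _ 1 1).
    by rewrite divff ?mul1r ?pnatr_eq0.
  case: (NV d nzd) => ->;
    rewrite E e1e1 subrr !mul0r add0r -(natrD _ 1 1) divff ?pnatr_eq0 //.
    by rewrite addr0 subr0 !mul1r add0r.
  have -> : 1 + (2 + 1) = 4 :> C by ring.
  by field.
have -> : \sum_(d | d != 0) ((1 - e1 * s d) / 2 * G 2 (- e1) +
   (1 + e1 * s d) / 2 * (N d e / 3 * G 4 e1 + (1 - N d e / 3) * G 1 e1)) =
   (\sum_(d : K | d != 0) 1) * (G 2 (- e1) + G 1 e1) / 2
   + (\sum_(d | d != 0) s d) * (e1 / 2 * (G 1 e1 - G 2 (- e1)))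
   + (\sum_(d | d != 0) N d e) * ((G 4 e1 - G 1 e1) / 6)
   + (\sum_(d | d != 0) N d e * s d) * (e1 * (G 4 e1 - G 1 e1) / 6).
  by rewrite !mulr_suml -!big_split; apply: eq_bigr => d _ /=; field.
rewrite sum_sign // sum_card_cubic_root // sum_card_cubic_root_sign //.
have : \sum_(y : K) (1 : C) = q by rewrite sumr_const.
rewrite (bigD1 0) //= => <-.
set S1 := \sum_(_ | _) _; have {}e1e1 : e1 ^+ 2 = 1 by rewrite expr2.
by field: e1e1.
Qed.

(** For [e = 0] the cubic is [d a^3 = 1] up to a factor: each nonzero [a] is a
    root for one [d], and the number of roots is [0] or [2 + e1]. *)
Lemma radical_statistics0 (G : C -> C) :
  \sum_(d : K | d != 0) G #|radical d 0|%:R =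
  (q - 1) / (2 + e1) * (G (3 + e1) + (1 + e1) * G 1).
Proof.
have nz : 2 + e1 != 0.
  case: (psi_pm r C (1 : K)) => ->; first by rewrite -(natrD _ 2 1) pnatr_eq0.
  have -> : 2 - 1 = 1 :> C by ring.
  exact: oner_neq0.
have NV d : d != 0 -> N d 0 = 0 \/ N d 0 = 2 + e1.
  move=> nzd; have [/existsP[a Ra]|no] := boolP [exists a, cubic_root d 0 a].
    by right; rewrite (card_cubic_root nzd Ra) mul0r psi0 mulr1.
  left; rewrite eq_card0 // => a; apply/negP => Ra; case/negP: no.
  by apply/existsP; exists a.
have card1 : \sum_(d : K | d != 0) (1 : C) = q - 1.
  have : \sum_(y : K) (1 : C) = q by rewrite sumr_const.
  by rewrite (bigD1 0) //= => <-; ring.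
have sumN : \sum_(d | d != 0) N d 0 = q - 1.
  rewrite -card1; under eq_bigr => d _ do rewrite -sum1_card natr_sum.
  rewrite (exchange_big_dep (fun a => a != 0)) /=; last first.
    by move=> d a nzd /(psi_cubic_root nzd)[].
  apply: eq_bigr => a nza; apply: (big_pred1 (a ^+ 3)^-1) => d /=.
  rewrite unfold_in /cubic_root expr0n mul0r addr0.
  have -> : d ^+ 2 * a ^+ 3 + d = d * (d * a ^+ 3 + 1) by ring.
  rewrite mulf_eq0 eq_addK; have [->|nzd] /= := eqVneq d 0.
    by apply/esym/negbTE; rewrite eq_sym invr_eq0 expf_eq0 /= (negPf nza) .
  rewrite -[RHS](inj_eq (mulIf (_ : a ^+ 3 != 0))) ?expf_eq0 //.
  by rewrite mulVf ?expf_eq0.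
transitivity (\sum_(d : K | d != 0)
    (N d 0 / (2 + e1) * G (3 + e1) + (1 - N d 0 / (2 + e1)) * G 1)).
  apply: eq_bigr => d nzd; rewrite card_radical //; case: (NV d nzd) => ->.
    by rewrite addr0 !mul0r subr0 add0r mul1r.
  by rewrite divff // subrr mul0r addr0 mul1r addrA.
have -> : \sum_(d : K | d != 0)
    (N d 0 / (2 + e1) * G (3 + e1) + (1 - N d 0 / (2 + e1)) * G 1) =
  (\sum_(d : K | d != 0) 1) * G 1
  + (\sum_(d | d != 0) N d 0) * ((G (3 + e1) - G 1) / (2 + e1)).
  by rewrite !mulr_suml -big_split; apply: eq_bigr => d _ /=; field.
by rewrite sumN card1; field.
Qed.
End RadicalStatistics.

(** * The number of elements *)

Section Totals.
Variable C : numFieldType.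
Implicit Types (Q R eps : C).

(** The average of [(lucas rho j).1] over the characters that differ by an
    additive character of [a]: one in [R] of them has [rho = R], and the others
    have [rho = 0]. *)
Definition even_weight R j :=
  (lucas 0 j).1 + ((lucas R j).1 - (lucas 0 j).1) / R.

(** In [odd_total] and [even_total] the sign [eps] is [psi 1]; the summands come
    from the characters with [d = 0], from those with [h = 0], and from the
    three cases of [radical_statistics]. *)
Definition odd_total eps Q j :=
  eps ^+ uphalf j + ((lucas (3 + eps) j).2 + (1 + eps) * (lucas 1 j).2) / (2 + eps) +
  ((Q - 1 + eps) / 2 * (- eps) ^+ uphalf j * (lucas 2 j).2
   + (Q - 3 - eps) / 6 * eps ^+ uphalf j * (lucas 4 j).2
   + (Q - eps) / 3 * eps ^+ uphalf j * (lucas 1 j).2).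

Definition even_total eps Q j :=
  (even_weight (3 + eps) j + (1 + eps) * even_weight 1 j) / (2 + eps) +
  if odd j then 0 else eps ^+ uphalf j +
    ((Q - 1 + eps) / 2 * (- eps) ^+ uphalf j * even_weight 2 j
     + (Q - 3 - eps) / 6 * eps ^+ uphalf j * even_weight 4 j
     + (Q - eps) / 3 * eps ^+ uphalf j * even_weight 1 j).
End Totals.

Section SumOfTotals.
Variables (K L : finFieldType) (i : {rmorphism K -> L}) (r n : nat).
Variables (C : numFieldType) (I : C).
Hypotheses (cardK : #|K| = (2 ^ r)%N) (sqrI : I ^+ 2 = -1).
Hypotheses (char2 : 2%N \in [pchar K]) (q_nat : [pchar L].-nat #|K|).
Hypothesis splits : forall f : {poly K}, f \is monic -> (size f <= n.+1)%N ->
  exists s, map_poly i f = \prod_(x <- s) ('X - x%:P).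
Hypothesis n_ge3 : (3 <= n)%N.

Local Notation q := (#|K|%:R : C).
Local Notation total := (@char_total K L i r C I).
Local Notation e1 := (psi r C (1 : K)).

Let char2L : 2%N \in [pchar L].
Proof. by rewrite (fmorph_pchar i). Qed.

(** Orthogonality of the characters. *)
Lemma sum_char_total :
  \sum_d \sum_h total d h n = q ^+ 3 *
  #|[set a : L | [&& iter n (frob i) a == a, T1 #|K| n a == 0, T2 #|K| n a == 0
                   & T3 #|K| n a == 0]]|%:R.
Proof.
transitivity (\sum_(a | iter n (frob i) a == a) \sum_d \sum_h \sum_k
    poly_char r I d h k (char_poly_over i n a)).
  rewrite [RHS]exchange_big; apply: eq_bigr => d _ /=.
  rewrite [RHS]exchange_big; apply: eq_bigr => h _ /=.
  by rewrite [RHS]exchange_big.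
rewrite -sum1_card natr_sum mulr_sumr big_mkcond [RHS]big_mkcond.
apply: eq_bigr => a _; rewrite inE; case: eqP => //= na.
rewrite triple_char_sum // mulr1.
have [<- <- <-] := top_coef_char_poly_over q_nat char2L na.
by rewrite !fmorph_eq0.
Qed.

Let q_sub1 : \sum_(h : K | h != 0) (1 : C) = q - 1.
Proof.
have : \sum_(y : K) (1 : C) = q by rewrite sumr_const.
by rewrite (bigD1 0) //= => <-; ring.
Qed.

Lemma sum_char_total_split (G : C -> C -> C) (G0 : C -> C) (T0 : C) :
  (forall h, h != 0 -> total 0 h n = T0) ->
  (forall d, d != 0 -> total d 0 n = G0 #|radical d 0|%:R) ->
  (forall d h, d != 0 -> h != 0 -> total d h n =
     G #|radical d (h ^+ 2)|%:R (psi r C (h ^+ 2 * (h ^+ 2 / d) ^+ 2))) ->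
  \sum_d \sum_h total d h n = total 0 0 n + (q - 1) * (T0 +
     (G0 (3 + e1) + (1 + e1) * G0 1) / (2 + e1) +
     ((q - 1 + e1) / 2 * G 2 (- e1) + (q - 3 - e1) / 6 * G 4 e1
      + (q - e1) / 3 * G 1 e1)).
Proof.
move=> E0 Ed0 Edh.
rewrite (bigD1 0) //= (bigD1 0) //= -addrA; congr (_ + _).
rewrite (eq_bigr (fun=> T0 * 1)) => [|h nzh]; last by rewrite E0 ?mulr1.
rewrite -mulr_sumr q_sub1 exchange_big (bigD1 0) //=.
rewrite (eq_bigr _ Ed0) (radical_statistics0 cardK char2).
set A := _ * G 2 _ + _ + _; rewrite (eq_bigr (fun=> A * 1)) => [|h nzh].
  by rewrite -mulr_sumr q_sub1; ring.
rewrite mulr1 /A -(radical_statistics cardK char2 G (_ : h ^+ 2 != 0)) ?expf_neq0 //.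
by apply: eq_bigr => d nzd; apply: Edh.
Qed.

Lemma sum_char_total_odd j : n = j.*2.+1 ->
  \sum_d \sum_h total d h n = total 0 0 n + q ^+ j.+1 * (q - 1) * odd_total e1 q j.
Proof.
move=> nE; have j_gt0 : (0 < j)%N by move: n_ge3; rewrite nE; case: (j).
rewrite (@sum_char_total_split
  (fun R s => q ^+ j.+1 * s ^+ uphalf j * (lucas R j).2)
  (fun R => q ^+ j.+1 * (lucas R j).2) (q ^+ j.+1 * e1 ^+ uphalf j)).
- by rewrite /odd_total; ring.
- move=> h nzh; rewrite nE.
  by apply: (proj2 (char_total_d0 cardK sqrI char2 q_nat splits n_ge3
    nzh j_gt0)); rewrite nE.
- move=> d nzd; rewrite nE.
  rewrite (proj2 (char_total_d cardK sqrI char2 q_nat splits n_ge3 0 nzd j_gt0)) ?nE //.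
  by rewrite expr0n mul0r psi0 expr1n mulr1.
move=> d h nzd nzh; rewrite nE.
by rewrite (proj2 (char_total_d cardK sqrI char2 q_nat splits n_ge3 h nzd j_gt0)) ?nE.
Qed.

Lemma sum_char_total_even j : n = j.*2 ->
  \sum_d \sum_h total d h n = total 0 0 n - q ^+ j.+1 * (q - 1) * even_total e1 q j.
Proof.
move=> nE; have j_gt0 : (0 < j)%N by move: n_ge3; rewrite nE; case: (j).
rewrite (@sum_char_total_split
  (fun R s => if odd j then 0 else - (q ^+ j.+1 * s ^+ uphalf j * even_weight R j))
  (fun R => - (q ^+ j.+1 * even_weight R j))
  (if odd j then 0 else - (q ^+ j.+1 * e1 ^+ uphalf j))).
- by rewrite /even_total; case: (odd j); ring.
- move=> h nzh; rewrite nE.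
  by apply: (proj1 (char_total_d0 cardK sqrI char2 q_nat splits n_ge3
    nzh j_gt0)); rewrite nE.
- move=> d nzd; rewrite nE.
  rewrite (proj1 (char_total_d cardK sqrI char2 q_nat splits n_ge3 0 nzd j_gt0)) ?nE //.
  by rewrite eqxx andbF expr0n mul0r psi0 expr1n mulr1.
move=> d h nzd nzh; rewrite nE.
rewrite (proj1 (char_total_d cardK sqrI char2 q_nat splits n_ge3 h nzd j_gt0)) ?nE //.
by rewrite nzh andbT.
Qed.
End SumOfTotals.

Section TraceCount.
Variables (r q n : nat) (F : finFieldType) (C : numFieldType) (I : C).
Hypotheses (r_gt0 : (1 <= r)%N) (qE : q = (2 ^ r)%N) (n_ge3 : (3 <= n)%N).
Hypotheses (cardF : #|F| = (q ^ n)%N) (sqrI : I ^+ 2 = -1).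

Local Notation Q := (q%:R : C).
Local Notation e1 := ((-1) ^+ r : C).
Local Notation cnt := ((trace_count q n (0 : F) 0 0)%:R : C).

(** The field [L] contains a copy of [F] as the set of fixed points of the [n]-th
    power of Frobenius, and [K] is the subfield of [F] with [q] elements. *)
Lemma trace_count_total :
  (forall j, n = j.*2.+1 ->
     Q ^+ 3 * cnt = Q ^+ n + Q ^+ j.+1 * (Q - 1) * odd_total e1 Q j) /\
  (forall j, n = j.*2 ->
     Q ^+ 3 * cnt = Q ^+ n - Q ^+ j.+1 * (Q - 1) * even_total e1 Q j).
Proof.
have cF2 : #|F| = (2 ^ (r * n))%N by rewrite cardF qE expnM.
have char2F : 2%N \in [pchar F] by apply: card_finPcharP cF2 _.
pose K : finFieldType := fixed_subfield r char2F.
have cK : #|K| = (2 ^ r)%N.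
  by apply: (@card_fixed_subfield _ _ _ _ n) => //; rewrite -qE.
have cKq : #|K| = q by rewrite cK qE.
have char2K : 2%N \in [pchar K] by apply: card_finPcharP cK _.
have [L [j splitsF]] := small_degree_splitting_field F n.
pose i : {rmorphism K -> L} := GRing.RMorphism.clone _ _ (j \o fixed_emb r char2F) _.
have char2L : 2%N \in [pchar L] by rewrite (fmorph_pchar j).
have nat_pow m : [pchar L].-nat (2 ^ m)%N.
  by rewrite (eq_pnat _ (pcharf_eq char2L)) pnatX pnat_id.
have q_nat : [pchar L].-nat #|K| by rewrite cK.
have splits (f : {poly K}) : f \is monic -> (size f <= n.+1)%N ->
    exists s, map_poly i f = \prod_(x <- s) ('X - x%:P).
  move=> mf sf; have [||s Es] := splitsF (map_poly (fixed_emb r char2F) f).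
  - by rewrite map_monic.
  - by rewrite size_map_poly.
  by exists s; rewrite -Es -map_poly_comp.
have fixedE a : (iter n (frob i) a == a) = (frob j a == a).
  by rewrite iter_frob cKq /frob cardF.
have fixedP a : reflect (exists y, a = j y) (iter n (frob i) a == a).
  by rewrite fixedE; apply: frob_fixedP.
have Tj b : [/\ T1 q n (j b) = j (T1 q n b), T2 q n (j b) = j (T2 q n b)
    & T3 q n (j b) = j (T3 q n b)].
  rewrite /T1 /T2 /T3; split; rewrite rmorph_sum; apply: eq_bigr => l _;
    rewrite ?rmorphXn // rmorph_sum; apply: eq_bigr => m _; rewrite ?rmorphXn //.
  by rewrite rmorph_sum; apply: eq_bigr => t _; rewrite rmorphXn.
have card_fixed : #|[set a : L | iter n (frob i) a == a]| = (q ^ n)%N.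
  rewrite -cardF -cardsT -(card_imset _ (fmorph_inj j)); apply: eq_card => a.
  rewrite inE; apply/fixedP/imsetP => [[b ->]|[b _ ->]]; last by exists b.
  by exists b; rewrite ?inE.
have card_zero : #|[set a : L | [&& iter n (frob i) a == a, T1 #|K| n a == 0,
    T2 #|K| n a == 0 & T3 #|K| n a == 0]]| = trace_count q n (0 : F) 0 0.
  rewrite cKq /trace_count -(card_imset _ (fmorph_inj j)); apply: eq_card => a.
  rewrite inE; apply/andP/imsetP => [[/fixedP[b ->]]|[b]].
    by have [-> -> ->] := Tj b; rewrite !fmorph_eq0 => Tb; exists b; rewrite ?inE.
  rewrite inE => Tb ->; split; first by apply/fixedP; exists b.
  by have [-> -> ->] := Tj b; rewrite !fmorph_eq0.
have e1E : psi r C (1 : K) = e1.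
  rewrite -signr_odd /psi /bit_sign /T1; under eq_bigr do rewrite expr1n.
  rewrite sumr_const card_ord (mulrn_odd char2K).
  by case: (odd r); rewrite ?oner_eq0 ?eqxx.
have total00 : char_total i r I 0 0 n = Q ^+ n.
  rewrite (char_total_00 cK sqrI char2K q_nat splits n_ge3) ?leqnn ?andbT.
    by rewrite card_fixed natrX.
  exact: leq_trans n_ge3.
have := sum_char_total i n I cK char2K q_nat.
rewrite card_zero [in RHS]cKq => <-.
split=> m nE.
  by rewrite (sum_char_total_odd cK sqrI char2K q_nat splits n_ge3 nE) total00 e1E cKq.
by rewrite (sum_char_total_even cK sqrI char2K q_nat splits n_ge3 nE) total00 e1E cKq.
Qed.
End TraceCount.

(** * Periodic tables *)

Lemma iter_table (T : Type) (f : T -> T) (x0 : T) (tab : seq T) (p : nat) j :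
  nth x0 tab 0 = x0 ->
  (forall k, (k < p.+1)%N -> f (nth x0 tab k) = nth x0 tab (k.+1 %% p.+1)) ->
  iter j f x0 = nth x0 tab (j %% p.+1).
Proof.
move=> tab0 step; elim: j => [|j IHj]; first by rewrite mod0n.
by rewrite iterS IHj step ?ltn_pmod // -[in LHS]addn1 modnDml addn1.
Qed.

Section PeriodicTables.
Variable C : numFieldType.
Implicit Types (j n : nat).

Lemma lucas0E j : (lucas (0 : C) j).1 = 2 * (-1) ^+ j.
Proof.
elim: j => [|j IHj]; first by rewrite expr0 mulr1.
by rewrite /lucas /= -/(lucas 0 j) IHj exprS; ring.
Qed.

Lemma lucas1E j : lucas (1 : C) j =
  nth (2, 1) [:: (2, 1); (- 1, - 2); (- 1, 1)] (j %% 3).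
Proof.
apply: iter_table => // -[|[|[|]]] //= _; congr pair; rewrite /=; ring.
Qed.

Lemma lucas2E j : lucas (2 : C) j =
  nth (2, 1) [:: (2, 1); (0, - 1); (- 2, - 1); (0, 1)] (j %% 4).
Proof.
apply: iter_table => // -[|[|[|[|]]]] //= _; congr pair; rewrite /=; ring.
Qed.

Lemma lucas4E j : lucas (4 : C) j = (2, 1).
Proof.
rewrite /lucas (@iter_table _ _ _ [:: (2, 1)] 0) ?modn1 // => -[|] //= _.
by congr pair; rewrite /=; ring.
Qed.

Lemma sign_uphalf j : (-1) ^+ uphalf j = (-1) ^+ uphalf (j %% 12) :> C.
Proof.
have -> : uphalf j = (6 * (j %/ 12) + uphalf (j %% 12))%N.
  rewrite {1}(divn_eq j 12); have -> : (j %/ 12 * 12 = (6 * (j %/ 12)).*2)%N by lia.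
  by rewrite !uphalf_half oddD halfD odd_double /= add0n doubleK addnCA.
by rewrite exprD exprM -signr_odd expr1n mul1r.
Qed.

Variables (x y w : C).
Hypotheses (x2 : x ^+ 2 = 2) (y2 : y ^+ 2 = 3).
Local Notation h := (x * (1 + y) / 2).
Hypotheses (w24 : w ^+ 24 = 1) (wD : w + w ^+ 23 = h).

(** As [w ^+ 23] is the inverse of [w], this is twice the cosine of [n] times
    the angle of [w]. *)
Definition two_cos n : C := w ^+ n + w ^+ (23 * n).

Definition two_cos_table : seq C :=
  [:: 2; h; y; x; 1; h - x; 0; x - h; - 1; - x; - y; - h;
      - 2; - h; - y; - x; - 1; x - h; 0; h - x; 1; x; y; h].

(** Both sides satisfy the recurrence
    [two_cos (n + 2) = two_cos 1 * two_cos (n + 1) - two_cos n]. *)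
Lemma two_cosE n : two_cos n = nth 2 two_cos_table (n %% 24).
Proof.
pose g (p : C * C) := (p.2, h * p.2 - p.1).
have E m : iter m g (2, h) = (two_cos m, two_cos m.+1).
  elim: m => [|m IHm]; first by rewrite -wD.
  rewrite iterS IHm /g /=; congr pair; rewrite -wD /two_cos.
  have -> : w ^+ (23 * m.+2) = w ^+ 23 * w ^+ 23 * w ^+ (23 * m).
    by rewrite -!exprD; congr (_ ^+ _); lia.
  have -> : w ^+ (23 * m.+1) = w ^+ 23 * w ^+ (23 * m).
    by rewrite -!exprD; congr (_ ^+ _); lia.
  rewrite !exprS; ring: w24.
have := E n; pose pairs := zip two_cos_table (rot 1 two_cos_table).
rewrite (@iter_table _ g (2, h) pairs 23) // => [Ek|k].
  have := congr1 fst Ek; rewrite /= => <-.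
  by rewrite nth_zip.
have h2 : h * h = 2 + y by field: x2 y2.
have hy : h * y = h + x by field: x2 y2.
have hx : h * x = 1 + y by field: x2 y2.
rewrite /pairs /two_cos_table /g; move: h h2 hy hx => h' h2 hy hx.
do 24![case: k => [|k]; first by move=> _; rewrite /=; congr pair;
   rewrite /= ?(mulrBr, mulrN, h2, hy, hx); ring].
by [].
Qed.

Variables (Q s t : C).
Hypotheses (s2 : s ^+ 2 = Q) (tE : t = x * s).

(** The factors of [q^(n/2 - 3)] in the final formulas, for [r] odd and for [r]
    even, with the roots of unity grouped in conjugate pairs. *)
Definition odd_degree_bracket n : C :=
  Q * (Q - 1) * (Q - 2) / 8 * (1 + (-1) ^+ n)
  + Q * (Q - 1) * (Q + 2) / 8 * two_cos (6 * n)
  + (Q - 1) * (Q + 1) * (Q - t) / 12 * (two_cos n + two_cos (7 * n))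
  + (Q - 1) * (Q + 1) * (Q + t) / 12 * (two_cos (5 * n) + two_cos (11 * n))
  + (Q - 1) * (Q - t) * (5 * Q + t + 4) / 24 * two_cos (3 * n)
  + (Q - 1) * (Q + t) * (5 * Q - t + 4) / 24 * two_cos (9 * n).

Definition even_degree_bracket n : C :=
  (Q - 1) * (Q - 2 * s) * (5 * Q + 2 * s + 4) / 24
  + (Q - 1) * (Q + 2 * s) * (5 * Q - 2 * s + 4) / 24 * (-1) ^+ n
  + Q * (Q - 1) * (5 * Q + 4) / 24 * two_cos (6 * n)
  + Q ^+ 2 * (Q - 1) / 8 * (two_cos (3 * n) + two_cos (9 * n))
  + Q * (Q - 1) ^+ 2 / 12 * (two_cos (2 * n) + two_cos (10 * n))
  + (Q - 1) * (Q - s) * (Q - s + 2) / 12 * two_cos (4 * n)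
  + (Q - 1) * (Q + s) * (Q + s + 2) / 12 * two_cos (8 * n).

Let two_cos_odd a j :
  two_cos (a * j.*2.+1) = nth 2 two_cos_table ((a * (j %% 12).*2.+1) %% 24).
Proof.
rewrite two_cosE -modnMmr -[in RHS]modnMmr; congr (nth _ _ ((_ * _) %% _)%N).
by rewrite {1}(divn_eq j 12); lia.
Qed.

Let two_cos_even a j :
  two_cos (a * j.*2) = nth 2 two_cos_table ((a * (j %% 12).*2) %% 24).
Proof.
rewrite two_cosE -modnMmr -[in RHS]modnMmr; congr (nth _ _ ((_ * _) %% _)%N).
by rewrite {1}(divn_eq j 12); lia.
Qed.

Let mod3 j : (j %% 3 = j %% 12 %% 3)%N. Proof. by rewrite modn_dvdm. Qed.
Let mod4 j : (j %% 4 = j %% 12 %% 4)%N. Proof. by rewrite modn_dvdm. Qed.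
Let odd12 j : odd j = odd (j %% 12).
Proof. by rewrite [in LHS](divn_eq j 12) oddD oddM andbF. Qed.

Let sign12 j : (-1) ^+ j = (-1) ^+ (j %% 12) :> C.
Proof. by rewrite -signr_odd odd12 signr_odd. Qed.
Let sign_double j : (-1) ^+ j.*2 = 1 :> C.
Proof. by rewrite -signr_odd odd_double. Qed.

Ltac eval_mod := repeat match goal with |- context [modn ?a ?b] =>
  let v := eval vm_compute in (modn a b) in change (modn a b) with v end.

(** In this lemma and the three following ones both sides only depend on [j]
    modulo 12, and the twelve cases are identities between polynomials in [s],
    [x] and [y]. *)
Lemma odd_degree_bracket_odd j :
  s * odd_degree_bracket j.*2.+1 = - (Q * (Q - 1) * odd_total (-1) Q j).
Proof.
rewrite /odd_degree_bracket -[X in two_cos X + _]mul1n !two_cos_odd.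
rewrite /odd_total; have -> : 3 + - 1 = 2 :> C by ring.
rewrite lucas1E lucas2E lucas4E mod3 mod4 sign_uphalf opprK expr1n.
rewrite exprS sign_double.
move: (j %% 12)%N (ltn_pmod j (isT : 0 < 12)%N) => l lt_l.
rewrite tE -s2 /two_cos_table.
do 12![case: l lt_l => [|l] lt_l; first by eval_mod; rewrite /=; field: x2].
by [].
Qed.

Lemma odd_degree_bracket_even j :
  odd_degree_bracket j.*2 = Q * (Q - 1) * even_total (-1) Q j.
Proof.
rewrite /odd_degree_bracket -[X in two_cos X + _]mul1n !two_cos_even.
rewrite /even_total /even_weight; have -> : 3 + - 1 = 2 :> C by ring.
rewrite lucas0E lucas1E lucas2E lucas4E mod3 mod4 sign_uphalf opprK expr1n.
rewrite sign_double (sign12 j) (odd12 j).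
move: (j %% 12)%N (ltn_pmod j (isT : 0 < 12)%N) => l lt_l.
rewrite tE -s2 /two_cos_table.
do 12![case: l lt_l => [|l] lt_l; first by eval_mod; rewrite /=; field: x2].
by [].
Qed.

Lemma even_degree_bracket_odd j :
  s * even_degree_bracket j.*2.+1 = - (Q * (Q - 1) * odd_total 1 Q j).
Proof.
rewrite /even_degree_bracket !two_cos_odd.
rewrite /odd_total; have -> : 3 + 1 = 4 :> C by ring.
rewrite lucas1E lucas2E lucas4E mod3 mod4 sign_uphalf expr1n.
rewrite exprS sign_double.
move: (j %% 12)%N (ltn_pmod j (isT : 0 < 12)%N) => l lt_l.
rewrite -s2 /two_cos_table.
do 12![case: l lt_l => [|l] lt_l; first by eval_mod; rewrite /=; field: x2].
by [].
Qed.

Lemma even_degree_bracket_even j :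
  even_degree_bracket j.*2 = Q * (Q - 1) * even_total 1 Q j.
Proof.
rewrite /even_degree_bracket !two_cos_even.
rewrite /even_total /even_weight; have -> : 3 + 1 = 4 :> C by ring.
rewrite lucas0E lucas1E lucas2E lucas4E mod3 mod4 sign_uphalf expr1n.
rewrite sign_double (sign12 j) (odd12 j).
move: (j %% 12)%N (ltn_pmod j (isT : 0 < 12)%N) => l lt_l.
rewrite -s2 /two_cos_table.
do 12![case: l lt_l => [|l] lt_l; first by eval_mod; rewrite /=; field: x2].
by [].
Qed.
End PeriodicTables.

(** * Roots of unity and the final formula *)

Section RootsOfUnity.
Variable R : realType.

Lemma cis_exp (a : R) n :
  Complex (cos a) (sin a) ^+ n = Complex (cos (a *+ n)) (sin (a *+ n)).
Proof.
elim: n => [|n IHn]; first by rewrite mulr0n cos0 sin0.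
rewrite exprS IHn mulrS cosD sinD; apply/eqP.
by rewrite eq_complex /= addrC eqxx /= addrC [sin a * _]mulrC [X in X + _]mulrC eqxx.
Qed.

Lemma omega_exp m k : (0 < k)%N -> (0 < m)%N -> omega R (k * m) ^+ m = omega R k.
Proof.
move=> k_gt0 m_gt0; rewrite /omega cis_exp natrM.
have -> : 2 * pi / (k%:R * m%:R) *+ m = 2 * pi / k%:R :> R.
  by rewrite -mulr_natl; field; rewrite !pnatr_eq0 -!lt0n k_gt0 m_gt0.
by [].
Qed.

Lemma omega_order k : (0 < k)%N -> omega R k ^+ k = 1.
Proof.
move=> k_gt0; rewrite /omega cis_exp.
have -> : 2 * pi / k%:R *+ k = pi *+ 2 :> R.
  by rewrite -mulr_natl -[pi *+ 2]mulr_natl; field; rewrite pnatr_eq0 -lt0n.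
by rewrite cos2pi sin2pi.
Qed.

Lemma omega4 : omega R 4 = Complex 0 1.
Proof.
rewrite /omega; have -> : 2 * pi / 4 = pi / 2 :> R by field.
by rewrite cos_pihalf sin_pihalf.
Qed.

(** The duplication formula determines the square of [cos a]. *)
Lemma cos_half_pos (a c : R) : 0 < a < pi / 2 -> 0 <= c ->
  cos (a *+ 2) = c ^+ 2 *+ 2 - 1 -> cos a = c.
Proof.
move=> /andP[a0 a1] c0; rewrite cos_mulr2n => /addIr/eqP.
rewrite eqr_pMn2r // => /eqP Ec; apply/eqP.
have ca : 0 <= cos a by rewrite ltW // cos_gt0_pihalf // a1 andbT; lra.
by rewrite -(eqrXn2 (n := 2)) // Ec.
Qed.

(** The angle [2 pi / 3] is both the double and the supplement of [pi / 3], so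
    that [2 c^2 - 1 = - c] for [c = cos (pi / 3)]. *)
Lemma cos_pi3 : cos (pi / 3) = 1 / 2 :> R.
Proof.
have pi0 := pi_gt0 R.
have c0 : 0 < cos (pi / 3 : R) by apply: cos_gt0_pihalf; apply/andP; split; lra.
have := cos_mulr2n (pi / 3 : R).
have -> : (pi / 3 *+ 2 = - (pi / 3) + pi :> R) by rewrite -mulr_natl; field.
rewrite cosDpi cosN => E.
have : (cos (pi / 3) + 1) * (2 * cos (pi / 3) - 1) = 0 :> R by nra.
by move/eqP; rewrite mulf_eq0 => /orP[] /eqP; lra.
Qed.

Lemma cos_pi12 : cos (2 * pi / 24) = Num.sqrt 2 * (1 + Num.sqrt 3) / 4 :> R.
Proof.
have pi0 := pi_gt0 R; have s20 := sqrtr_ge0 (2 : R); have s30 := sqrtr_ge0 (3 : R).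
have s2 := sqr_sqrtr (ler0n R 2); have s3 := sqr_sqrtr (ler0n R 3).
have c6 : cos (pi / 6) = Num.sqrt 3 / 2 :> R.
  apply: cos_half_pos; [by apply/andP; split; lra | lra |].
  have -> : (pi / 6 *+ 2 = pi / 3 :> R) by rewrite -mulr_natl; field.
  by rewrite cos_pi3; field: s3.
apply: cos_half_pos; [by apply/andP; split; lra | nra |].
have -> : (2 * pi / 24 *+ 2 = pi / 6 :> R) by rewrite -mulr_natl; field.
by rewrite c6; field: s2 s3.
Qed.

Local Notation w := (omega R 24).

Lemma omega24_inv : w + w ^+ 23 =
  (Num.sqrt (2 : R))%:C%C * (1 + (Num.sqrt (3 : R))%:C%C) / 2.
Proof.
have -> : w ^+ 23 = Complex (cos (2 * pi / 24)) (- sin (2 * pi / 24)).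
  rewrite /omega cis_exp.
  have -> : 2 * pi / 24 *+ 23 = - (2 * pi / 24) + pi *+ 2 :> R.
    by rewrite -mulr_natl -[pi *+ 2]mulr_natl; field.
  by rewrite cosD2pi sinD2pi cosN sinN.
have -> : w + Complex (cos (2 * pi / 24)) (- sin (2 * pi / 24)) =
    (2 * cos (2 * pi / 24) : R)%:C%C.
  by apply/eqP; rewrite eq_complex /=; apply/andP; split; apply/eqP; ring.
rewrite cos_pi12; have -> : (2 * (Num.sqrt 2 * (1 + Num.sqrt 3) / 4) =
   Num.sqrt 2 * (1 + Num.sqrt 3) / 2 :> R) by field.
by rewrite !rmorphM rmorphD /= fmorphV rmorph1 rmorph_nat.
Qed.

Lemma omega24_reduce a k n : w ^+ ((a + 24 * k) * n) = w ^+ (a * n).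
Proof.
by rewrite mulnDl exprD -mulnA [w ^+ (24 * _)]exprM omega_order // expr1n mulr1.
Qed.

(** As [23 = -1] modulo 24, the hypothesis says that [b = - a] modulo 24. *)
Lemma omega24_pair a b k n : (23 * a = b + 24 * k)%N ->
  w ^+ (a * n) + w ^+ (b * n) = two_cos w (a * n).
Proof. by move=> E; rewrite /two_cos mulnA E omega24_reduce. Qed.

End RootsOfUnity.

Lemma powR_half_sub3 (R : realType) (Q : R) n : 0 < Q ->
  Q ^+ 3 * powR Q (n%:R / 2 - 3) = Num.sqrt Q ^+ n.
Proof.
move=> Q0; have Qn0 : Q != 0 by rewrite gt_eqF.
rewrite powRB ?Qn0 ?implybT // (powR_mulrn 3) ?ltW // mulrC mulfVK ?expf_neq0 //.
by rewrite mulrC powRrM powR12_sqrt ?ltW // powR_mulrn ?sqrtr_ge0.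
Qed.

Theorem theorem8 (R : realType) (r q n : nat) (F : finFieldType)
    (hr : (1 <= r)%N) (hq : q = (2 ^ r)%N) (hn : (3 <= n)%N)
    (hF : #|F| = (q ^ n)%N) :
  let Q : R := q%:R in
  let s : R := Num.sqrt Q in
  let t : R := Num.sqrt (2 * Q) in
  let I : R[i] := Complex 0 1 in
  let w8 := omega R 8 in
  let w24 := omega R 24 in
  let w12 := omega R 12 in
  let w6 := omega R 6 in
  (odd r ->
    (trace_count q n (0 : F) 0 0)%:R =
      (Q ^+ (n - 3))%:C%C - (powR Q (n%:R / 2 - 3))%:C%C *
        ((Q * (Q - 1) * (Q - 2) / 8)%:C%C * (1 ^+ n + (-1) ^+ n)
         + (Q * (Q - 1) * (Q + 2) / 8)%:C%C * (I ^+ n + (- I) ^+ n)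
         + ((Q - 1) * (Q + 1) * (Q - t) / 12)%:C%C *
             (w24 ^+ n + w24 ^+ (7 * n) + w24 ^+ (17 * n) + w24 ^+ (23 * n))
         + ((Q - 1) * (Q + 1) * (Q + t) / 12)%:C%C *
             (w24 ^+ (5 * n) + w24 ^+ (11 * n) + w24 ^+ (13 * n)
              + w24 ^+ (19 * n))
         + ((Q - 1) * (Q - t) * (5 * Q + t + 4) / 24)%:C%C *
             (w8 ^+ n + w8 ^+ (7 * n))
         + ((Q - 1) * (Q + t) * (5 * Q - t + 4) / 24)%:C%C *
             (w8 ^+ (3 * n) + w8 ^+ (5 * n))))
  /\
  (~~ odd r ->
    (trace_count q n (0 : F) 0 0)%:R =
      (Q ^+ (n - 3))%:C%C - (powR Q (n%:R / 2 - 3))%:C%C *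
        (((Q - 1) * (Q - 2 * s) * (5 * Q + 2 * s + 4) / 24)%:C%C * 1 ^+ n
         + ((Q - 1) * (Q + 2 * s) * (5 * Q - 2 * s + 4) / 24)%:C%C * (-1) ^+ n
         + (Q * (Q - 1) * (5 * Q + 4) / 24)%:C%C * (I ^+ n + (- I) ^+ n)
         + (Q ^+ 2 * (Q - 1) / 8)%:C%C *
             (w8 ^+ n + w8 ^+ (7 * n) + w8 ^+ (3 * n) + w8 ^+ (5 * n))
         + (Q * (Q - 1) ^+ 2 / 12)%:C%C *
             (w12 ^+ n + w12 ^+ (5 * n) + w12 ^+ (7 * n) + w12 ^+ (11 * n))
         + ((Q - 1) * (Q - s) * (Q - s + 2) / 12)%:C%C *
             (w6 ^+ n + w6 ^+ (5 * n))
         + ((Q - 1) * (Q + s) * (Q + s + 2) / 12)%:C%C *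
             (w6 ^+ (2 * n) + w6 ^+ (4 * n)))).
Proof.
move=> Q s t I w8 w24 w12 w6.
have Q_gt0 : 0 < Q by rewrite ltr0n hq expn_gt0.
pose x := (Num.sqrt (2 : R))%:C%C; pose y := (Num.sqrt (3 : R))%:C%C.
have sqrt_real (a : R) : 0 <= a -> (Num.sqrt a)%:C%C ^+ 2 = a%:C%C.
  by move=> a0; rewrite -rmorphXn /= sqr_sqrtr.
have x2 : x ^+ 2 = 2 by rewrite sqrt_real // rmorph_nat.
have y2 : y ^+ 2 = 3 by rewrite sqrt_real // rmorph_nat.
have s2 : s%:C%C ^+ 2 = Q%:C%C by apply/sqrt_real/ltW.
have tE : t%:C%C = x * s%:C%C by rewrite -rmorphM /= -sqrtrM.
have wn : w24 ^+ 24 = 1 by apply: omega_order.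
have wD : w24 + w24 ^+ 23 = x * (1 + y) / 2 by apply: omega24_inv.
have w8E m : w8 ^+ m = w24 ^+ (3 * m) by rewrite exprM (@omega_exp R 3 8).
have w12E m : w12 ^+ m = w24 ^+ (2 * m) by rewrite exprM (@omega_exp R 2 12).
have w6E m : w6 ^+ m = w24 ^+ (4 * m) by rewrite exprM (@omega_exp R 4 6).
have IE : I = w24 ^+ 6 by rewrite (@omega_exp R 6 4) ?omega4.
have pair a b k (Eab : (23 * a = b + 24 * k)%N) := omega24_pair R n Eab.
have pairI : I ^+ n + (- I) ^+ n = two_cos w24 (6 * n).
  have -> : - I = w24 ^+ 18.
    by rewrite (exprM w24 6 3 : w24 ^+ 18 = _) -IE exprS sqr_i mulrN1.
  by rewrite IE -!exprM (pair 6 18 5).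
have cntE B : (forall j, n = j.*2.+1 ->
      s%:C%C * B = - (Q%:C%C * (Q%:C%C - 1) * odd_total ((-1) ^+ r) Q%:C%C j)) ->
    (forall j, n = j.*2 ->
      B = Q%:C%C * (Q%:C%C - 1) * even_total ((-1) ^+ r) Q%:C%C j) ->
    (trace_count q n (0 : F) 0 0)%:R =
      (Q ^+ (n - 3))%:C%C - (powR Q (n%:R / 2 - 3))%:C%C * B.
  move=> oddB evenB.
  have QC : q%:R = Q%:C%C by rewrite rmorph_nat.
  have nzQ : Q%:C%C ^+ 3 != 0 by rewrite expf_eq0 fmorph_eq0 gt_eqF.
  have E1 : Q%:C%C ^+ 3 * (Q ^+ (n - 3))%:C%C = Q%:C%C ^+ n.
    by rewrite rmorphXn /= -exprD subnKC.
  have E2 : Q%:C%C ^+ 3 * (powR Q (n%:R / 2 - 3))%:C%C = s%:C%C ^+ n.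
    by rewrite -(rmorphXn (real_complex R)) -rmorphM /= powR_half_sub3 // rmorphXn.
  apply: (mulfI nzQ); rewrite mulrBr mulrA E1 E2.
  have [odd_eq even_eq] := trace_count_total hr hq hn hF (@sqr_i R).
  rewrite QC in odd_eq even_eq.
  have := odd_double_half n; move: (n./2) => j; case: (odd n) => /esym nE.
    have -> : s%:C%C ^+ n = Q%:C%C ^+ j * s%:C%C.
      by rewrite nE exprSr -mul2n exprM s2.
    by rewrite (odd_eq _ nE) -[in RHS]mulrA (oddB _ nE) exprS; ring.
  have -> : s%:C%C ^+ n = Q%:C%C ^+ j by rewrite nE -mul2n exprM s2.
  by rewrite (even_eq _ nE) (evenB _ nE) exprS; ring.
have pushC := (rmorphM (real_complex R), rmorphB (real_complex R),
  rmorphD (real_complex R), fmorphV (real_complex R), rmorphXn (real_complex R),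
  rmorph1 (real_complex R), rmorph_nat (real_complex R)).
split=> [odd_r|even_r].
  have sgn_r : (-1) ^+ r = -1 :> R[i] by rewrite -signr_odd odd_r.
  have := cntE (odd_degree_bracket w24 Q%:C%C t%:C%C n); rewrite sgn_r => -> //.
  - congr (_ - _ * _); rewrite expr1n pairI !w8E /odd_degree_bracket.
    rewrite -(pair 3 21 2) // -(pair 9 15 8) // -(pair 5 19 4) // -(pair 11 13 10) //.
    rewrite -(pair 7 17 6) // -/w24 !mulnA.
    rewrite !pushC.
    rewrite /two_cos; ring.
  - by move=> j ->; apply: (odd_degree_bracket_odd x2 y2 wn wD s2 tE).
  by move=> j ->; apply: (odd_degree_bracket_even x2 y2 wn wD s2 tE).
have sgn_r : (-1) ^+ r = 1 :> R[i] by rewrite -signr_odd (negPf even_r).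
have := cntE (even_degree_bracket w24 Q%:C%C s%:C%C n); rewrite sgn_r => -> //.
- congr (_ - _ * _); rewrite expr1n pairI !w8E !w12E !w6E /even_degree_bracket.
  rewrite -(pair 3 21 2) // -(pair 9 15 8) // -(pair 2 22 1) // -(pair 10 14 9) //.
  rewrite -(pair 4 20 3) // -(pair 8 16 7) // -/w24 !mulnA.
  rewrite !pushC.
  ring.
- by move=> j ->; apply: (even_degree_bracket_odd x2 y2 wn wD s2).
by move=> j ->; apply: (even_degree_bracket_even x2 y2 wn wD s2).
Qed.
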